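(* Let $\mathcal{P}$ be a finite polysquare translation surface, and let $\mathcal{M}=\mathcal{P}\times[0,1)$ be the associated polycube translation $3$-manifold, the cartesian product of $\mathcal{P}$ and the unit torus $[0,1)$. Let $\mathbf{v}\in\mathbb{R}^2$ be a Kronecker direction. Then the following statements are equivalent: (i) Geodesic flow with direction $\mathbf{v}$ on $\mathcal{P}$ is ergodic. (ii) For any $w\in\mathbb{R}$ such that $\mathbf{w}=(\mathbf{v},w)\in\mathbb{R}^3$ is a Kronecker direction, geodesic flow with direction $\mathbf{w}$ in $\mathcal{M}$ is ergodic.
   Context: A vector in $\mathbb{R}^2$ or $\mathbb{R}^3$ is a Kronecker direction if its coordinates are linearly independent over $\mathbb{Q}$ (for a direction normalized to have one coordinate equal to $1$, say $(v_1,\ldots,v_d,1)$, this says that $v_1,\ldots,v_d,1$ are linearly independent over $\mathbb{Q}$). A finite polysquare translation surface $\mathcal{P}$ is a connected surface obtained from finitely many, say $s$, unit squares with sides parallel to the axes (the atomic squares) by identifying their edges in pairs by translations (right edges with left edges, top edges with bottom edges). Its singularities are the vertices with total cone angle different from $2\pi$. The manifold $\mathcal{M}=\mathcal{P}\times[0,1)$, where $[0,1)=\mathbb{R}/\mathbb{Z}$ is the unit torus, consists of $s$ atomic cubes (atomic square times $[0,1)$); its singularities are the points $(p,z)$ with $p$ a singularity of $\mathcal{P}$. Geodesic flow with a given direction is the (almost everywhere defined, Lebesgue measure preserving) unit speed straight line flow in that direction, continued through the identifications as long as it does not hit a singularity. Ergodicity is with respect to $2$-dimensional Lebesgue measure on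 $\mathcal{P}$ and $3$-dimensional Lebesgue measure on $\mathcal{M}$. *)

(* Defs.v *)
From HB Require Import structures.
From mathcomp Require Import all_boot all_order all_algebra all_fingroup.
From mathcomp Require Import all_classical all_reals all_analysis.
Set Implicit Arguments.
Unset Strict Implicit.
Unset Printing Implicit Defensive.
Import Order.TTheory GRing.Theory Num.Theory.
Import numFieldNormedType.Exports.
Local Open Scope classical_set_scope.
Local Open Scope ring_scope.

Definition kronecker (R : realType) (d : nat) (v : 'rV[R]_d) : Prop :=
  forall q : 'I_d -> rat,
    \sum_(i < d) ratr (q i) * v 0 i = 0 -> forall i, q i = 0.

Definition euclid_norm (R : realType) (d : nat) (v : 'rV[R]_d) : R :=
  Num.sqrt (\sum_(i < d) v 0 i ^+ 2).

Definition unit_vector (R : realType) (d : nat) (v : 'rV[R]_d) : 'rV[R]_d :=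
  (euclid_norm v)^-1 *: v.

Definition edge_adjacent (S : finType) (r u : {perm S}) : rel S :=
  fun i j => [|| j == r i, i == r j, j == u i | i == u j].

(* The right edge of the square [i] is identified with the left edge of
   [right i], and the top edge of [i] with the bottom edge of [up i].  Squares
   are connected and all identifications come from edges, so the surface is
   connected when any two squares are joined by a chain of edge-adjacent
   ones. *)
Record polysquare := Polysquare {
  square : finType;
  right : {perm square};
  up : {perm square};
  square_gt0 : (0 < #|square|)%N;
  polysquare_connected : forall i j, connect (edge_adjacent right up) i j
}.

(* A quarter turn at a time, counterclockwise around the lower left vertex of
   [i] and starting from [i]: go left, down, right, up.  (In {perm _} the
   leftmost factor acts first.) *)
Definition full_turn (P : polysquare) : {perm square P} :=
  ((right P)^-1 * (up P)^-1 * right P * up P)%g.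

(* Total cone angle at the lower left vertex of [i]: the orbit of [i] lists the
   sheets met by turning around the vertex until closing up, each one
   contributing 2 pi. *)
Definition cone_angle (R : realType) (P : polysquare) (i : square P) : R :=
  2 * pi * #|porbit (full_turn P) i|%:R.

(* [(i, (x, y))] is the point with coordinates [(x, y)] in the square [i]. *)
Definition point2 (R : realType) (P : polysquare) : Type :=
  (square P * (R * R))%type.

(* Atomic squares are represented by [0, 1)^2, their right and top edges being
   the left and bottom edges of other squares.  Each point of the surface
   other than a singularity has exactly one representative (a singularity,
   where the flow is undefined, has one for each sheet). *)
Definition surface (R : realType) (P : polysquare) : set (point2 R P) :=
  [set p | (0 <= p.2.1 < 1) /\ (0 <= p.2.2 < 1)].

Definition singular2 (R : realType) (P : polysquare) : set (point2 R P) :=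
  [set p | p.2 = (0, 0) /\ cone_angle R p.1 <> 2 * pi].

Definition frac (R : realType) (x : R) : R := x - (Num.floor x)%:~R.

Definition cross (S : finType) (s : {perm S}) (m : int) (i : S) : S :=
  match m with
  | Posz n => iter n s i
  | Negz n => iter n.+1 (s^-1)%g i
  end.

(* Translation by [(a, b)] in the chart at [p].  It is only used at
   nonsingular points and for small [(a, b)], when at most one vertical and one
   horizontal edge get crossed; both get crossed only if [p] is a vertex of cone
   angle 2 pi, in which case [right P] and [up P] commute there and the order of
   the crossings is irrelevant. *)
Definition translate2 (R : realType) (P : polysquare) (a b : R)
    (p : point2 R P) : point2 R P :=
  let x := p.2.1 + a in
  let y := p.2.2 + b in
  (cross (up P) (Num.floor y) (cross (right P) (Num.floor x) p.1),
   (frac x, frac y)).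

Definition point3 (R : realType) (P : polysquare) : Type :=
  (point2 R P * R)%type.

Definition manifold (R : realType) (P : polysquare) : set (point3 R P) :=
  @surface R P `*` [set z | 0 <= z < 1].

Definition singular3 (R : realType) (P : polysquare) : set (point3 R P) :=
  [set q | @singular2 R P q.1].

Definition translate3 (R : realType) (P : polysquare) (a b c : R)
    (q : point3 R P) : point3 R P :=
  (translate2 a b q.1, frac (q.2 + c)).

(* [g], on the time interval [0, l], stays in [X] away from the singularities
   [sing] and moves locally by translation: [move h] is the local displacement
   along the direction during the small, possibly negative, time [h]. *)
Definition geodesic_on (R : realType) (T : Type) (X sing : set T)
    (move : R -> T -> T) (l : R) (g : R -> T) : Prop :=
  forall t : R, 0 <= t <= l ->
    (X `\` sing) (g t) /\
    (\forall h \near (0 : R), 0 <= t + h <= l -> g (t + h) = move h (g t)).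

(* The partially defined flow: the point [p] is carried to [q] in time [t]. *)
Definition flow (R : realType) (T : Type) (X sing : set T)
    (move : R -> T -> T) (t : R) (p q : T) : Prop :=
  0 <= t /\
  exists g : R -> T, [/\ geodesic_on X sing move t g, g 0 = p & g t = q].

(* Negative times are covered as well, by exchanging [p] and [q]. *)
Definition invariant_set (R : realType) (T : Type) (F : R -> T -> T -> Prop)
    (A : set T) : Prop :=
  forall (t : R) (p q : T), F t p q -> (A p <-> A q).

(* Invariance is exact along the flow and [meas] will be the Borel sets;
   changing [A] by a null set shows that allowing Lebesgue measurable sets that
   are invariant only modulo null sets gives the same notion. *)
Definition ergodic (R : realType) (T : Type) (X : set T)
    (meas : set (set T)) (mu : set T -> \bar R)
    (F : R -> T -> T -> Prop) : Prop :=
  forall A : set T, A `<=` X -> meas A -> invariant_set F A ->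
    mu A = 0%E \/ mu (X `\` A) = 0%E.

Definition leb2 (R : realType) :
    set (measurableTypeR R * measurableTypeR R) -> \bar R :=
  (lebesgue_measure \x lebesgue_measure)%E.

Definition leb3 (R : realType) :
    set (measurableTypeR R * measurableTypeR R * measurableTypeR R) -> \bar R :=
  ((lebesgue_measure \x lebesgue_measure) \x lebesgue_measure)%E.

Definition slice2 (R : realType) (P : polysquare) (A : set (point2 R P))
    (i : square P) : set (measurableTypeR R * measurableTypeR R) :=
  [set xy | A (i, xy)].

Definition slice3 (R : realType) (P : polysquare) (A : set (point3 R P))
    (i : square P) :
    set (measurableTypeR R * measurableTypeR R * measurableTypeR R) :=
  [set xyz | A ((i, xyz.1), xyz.2)].

Definition measurable2 (R : realType) (P : polysquare) : set (set (point2 R P)) :=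
  [set A | forall i, measurable (slice2 A i)].

Definition measurable3 (R : realType) (P : polysquare) : set (set (point3 R P)) :=
  [set A | forall i, measurable (slice3 A i)].

Definition area (R : realType) (P : polysquare) (A : set (point2 R P)) : \bar R :=
  (\sum_(i : square P) leb2 (slice2 A i))%E.

Definition volume (R : realType) (P : polysquare) (A : set (point3 R P)) : \bar R :=
  (\sum_(i : square P) leb3 (slice3 A i))%E.

Definition geodesic_flow2 (R : realType) (P : polysquare) (v : 'rV[R]_2) :
    R -> point2 R P -> point2 R P -> Prop :=
  let e := unit_vector v in
  flow (@surface R P) (@singular2 R P)
    (fun h => translate2 (h * e 0 0) (h * e 0 1)).

Definition geodesic_flow3 (R : realType) (P : polysquare) (w : 'rV[R]_3) :
    R -> point3 R P -> point3 R P -> Prop :=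
  let e := unit_vector w in
  flow (@manifold R P) (@singular3 R P)
    (fun h => translate3 (h * e 0 0) (h * e 0 1) (h * e 0 2)).

Definition ergodic2 (R : realType) (P : polysquare) (v : 'rV[R]_2) : Prop :=
  ergodic (@surface R P) (@measurable2 R P) (@area R P)
    (geodesic_flow2 (P := P) v).

Definition ergodic3 (R : realType) (P : polysquare) (w : 'rV[R]_3) : Prop :=
  ergodic (@manifold R P) (@measurable3 R P) (@volume R P)
    (geodesic_flow3 (P := P) w).

(* Main.v *)
Require Import Defs.
From HB Require Import structures.
From mathcomp Require Import all_boot all_order all_algebra all_fingroup.
From mathcomp Require Import all_classical all_reals all_analysis.
From mathcomp Require Import measurable_realfun ring lra.
Set Implicit Arguments.
Unset Strict Implicit.
Unset Printing Implicit Defensive.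
Import Order.TTheory GRing.Theory Num.Theory.
Import numFieldNormedType.Exports.
Import Defs.
Local Open Scope classical_set_scope.
Local Open Scope ring_scope.

(** The geodesic flow on [M] is the product of the flow on [P] with a rotation
of the circle: in time [t] it moves [(p, z)] to [(T_t p, z + t w)].

One implication is formal.  The rational span of the coordinates of [v] is
countable, so some [w] lies outside it ([kronecker_extension]), and the cylinder
over an invariant subset of [P] is an invariant subset of [M] ([ergodic_proj]).

For the other one, let [A] be an invariant subset of [M] and let [A_p] be its
fibre over [p] in [P], a subset of the circle.  Invariance says that
[A_(T_t p)] is [A_p] rotated by [t w].  It is enough to show that almost every
fibre is null or conull: the set of [p] with conull fibre is then invariant
under the flow on [P], hence null or conull by hypothesis, and Fubini's theorem
gives the same for [A] ([ergodic_lift]).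

To control the fibres, fix a length [d] and let [arc d z p] be the measure of
[A_p] in the window from [z] to [z + d].  Sending each atomic square to the unit
torus makes [P] a finite branched covering of the torus.  Except over the lines
through the lattice points, the flow on [P] carries the fibre of this covering
over [x] bijectively to the fibre over [x + t v] ([flow_fibres]), so the finite
set of the values [arc d z p], for [p] over [x], depends only on the orbit of
[(x, z)] under the linear flow with direction [(v, w)] on the torus of
dimension 3.  That flow is ergodic because [(v, w)] is a Kronecker direction;
hence this set of values is almost everywhere the same set
([attains_dichotomy]).  For a typical point [p], the function [arc d _ p] is
therefore continuous with finitely many values at rational arguments, so it is
constant ([regular_arc_le]).  A subset of the circle that has the same measure
in all windows of equal length is null or conull ([zero_one1],
[regular_fibre]).

Ergodicity of the linear flow is used on the sections [z] constant, where it
becomes ergodicity of the translation by [v / w] on the torus of dimension 2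
([zero_one2]).  The measure of an invariant set [E] in a box is a continuous
function of the position of the box, and the periods of this function form a
closed subgroup of the plane that contains the integer lattice and [v / w].  By
Kronecker's theorem ([subgroup2_full]) every vector is a period, so that [E] has
constant density, which can only be 0 or 1. *)

(** * Closed subgroups of the plane: Kronecker's theorem *)

Section Kronecker.
Variable R : realType.
Implicit Types (x y a b t e : R).

Definition irrational x := forall q : rat, x <> ratr q.

Lemma frac_ge0 x : 0 <= frac x.
Proof. by rewrite /frac subr_ge0 floor_le. Qed.

Lemma frac_lt1 x : frac x < 1.
Proof. by rewrite /frac ltrBlDl; have := floorD1_gt x; rewrite intrD1 addrC. Qed.

(** Simultaneous approximation, by the pigeonhole principle: among the first
[N ^ 2 + 1] multiples of [(x, y)], two have their fractional parts in the same
square of side [1 / N]. *)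
Lemma dirichlet (x y : R) (N : nat) : (0 < N)%N ->
  exists n : nat, exists p q : int, [/\ (0 < n)%N,
    `|n%:R * x - p%:~R| < N%:R^-1 & `|n%:R * y - q%:~R| < N%:R^-1].
Proof.
case: N => // N _.
pose bin (u : R) : 'I_N.+1 := inord (Num.truncn (N.+1%:R * frac u)).
have binP (u w : R) : bin u = bin w -> `|frac u - frac w| < N.+1%:R^-1.
  have N0 : (0 : R) < N.+1%:R by rewrite ltr0n.
  have bb (u' : R) : (bin u')%:R <= N.+1%:R * frac u' < (bin u')%:R + 1.
    have h0 : 0 <= N.+1%:R * frac u' by rewrite mulr_ge0 // frac_ge0.
    rewrite /bin inordK.
      by have := truncn_itv h0; rewrite -[(Num.truncn _).+1%:R]natr1.
    rewrite truncn_lt_nat // -[ltRHS]mulr1.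
    by rewrite ltr_pM2l // frac_lt1.
  move=> E; have := bb u; have := bb w; rewrite E => /andP[h1 h2] /andP[h3 h4].
  rewrite -(ltr_pM2l N0) mulfV ?gt_eqF // -[X in X * _]gtr0_norm // -normrM mulrBr.
  by rewrite ltr_norml; apply/andP; split; lra.
pose F (i : 'I_(N.+1 * N.+1).+1) := (bin (i%:R * x), bin (i%:R * y)).
have : ~~ injectiveb F.
  apply/negP => /injectiveP /leq_card.
  by rewrite card_prod !card_ord ltnn.
move=> /injectivePn [i [j ij Fij]].
wlog lt_ij : i j ij Fij / (j < i)%N.
  move=> W; case: (ltngtP j i) => h; first exact: (W i j).
    by apply: (W j i) => //; rewrite eq_sym.
  by move: ij; rewrite (ord_inj h) eqxx.
exists (i - j)%N, (Num.floor (i%:R * x) - Num.floor (j%:R * x)),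
  (Num.floor (i%:R * y) - Num.floor (j%:R * y)).
case: Fij => /binP hx /binP hy; rewrite subn_gt0; split => //.
- apply: le_lt_trans hx; rewrite le_eqVlt; apply/orP; left; apply/eqP.
  by congr `|_|; rewrite /frac natrB ?(ltnW lt_ij) // rmorphB /=; ring.
- apply: le_lt_trans hy; rewrite le_eqVlt; apply/orP; left; apply/eqP.
  by congr `|_|; rewrite /frac natrB ?(ltnW lt_ij) // rmorphB /=; ring.
Qed.

Definition subgroup1 (K : R -> Prop) := K 0 /\ forall x y, K x -> K y -> K (x - y).
Definition closed1 (K : R -> Prop) :=
  forall x, (forall e, 0 < e -> exists2 y, K y & `|x - y| < e) -> K x.

Lemma subgroup1_int K x (n : int) : subgroup1 K -> K x -> K (n%:~R * x).
Proof.
move=> [K0 KB] Kx.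
have KN y : K y -> K (- y) by move=> Ky; rewrite -[- y]add0r; apply: KB.
have Kn (m : nat) : K (m%:R * x).
  elim: m => [|m IH]; first by rewrite mul0r.
  rewrite -natr1 mulrDl mul1r -[X in _ + X]opprK; apply: KB => //; exact: KN.
case: n => m; first exact: Kn.
by rewrite NegzE mulrNz mulNr; apply: KN; apply: Kn.
Qed.

(** An irrational [x] has multiples arbitrarily close to, but different from,
integers, so [K] contains arbitrarily small steps. *)
Lemma subgroup1_irrational K x : subgroup1 K -> closed1 K -> K 1 -> K x ->
  irrational x -> forall y, K y.
Proof.
move=> sK cK K1 Kx irr y; apply: cK => e e0.
have [N N0 Ne] : exists2 N : nat, (0 < N)%N & N%:R^-1 < e.
  exists (Num.truncn e^-1).+1 => //.
  rewrite -[ltRHS]invrK ltf_pV2 ?posrE ?ltr0n ?invr_gt0 //.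
  exact: truncnS_gt.
have [n [p [_ [n0 hp _]]]] := dirichlet x x N0.
set k := n%:R * x - p%:~R in hp.
have Kk : K k.
  rewrite /k; apply: sK.2; first exact: (subgroup1_int (n : int)).
  by rewrite -[p%:~R]mulr1; apply: subgroup1_int.
have k0 : k != 0.
  apply/eqP => /eqP; rewrite subr_eq0 => /eqP h.
  apply: (irr (p%:Q / n%:Q)); rewrite rmorphM fmorphV /= !ratr_int -h.
  by rewrite mulrAC mulfV ?mul1r // pnatr_eq0 -lt0n.
exists ((Num.floor (y / k))%:~R * k); first exact: subgroup1_int.
have -> : y - (Num.floor (y / k))%:~R * k = frac (y / k) * k.
  by rewrite /frac mulrBl divfK.
rewrite normrM ger0_norm ?frac_ge0 //; apply: le_lt_trans (lt_trans hp Ne).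
by rewrite ler_piMl // ltW // frac_lt1.
Qed.

Definition subgroup2 (H : R * R -> Prop) :=
  H (0, 0) /\ forall h k, H h -> H k -> H (h.1 - k.1, h.2 - k.2).
Definition closed2 (H : R * R -> Prop) := forall h,
  (forall e, 0 < e -> exists k, [/\ H k, `|h.1 - k.1| < e & `|h.2 - k.2| < e]) ->
  H h.

Lemma subgroup2_int H h (n : int) : subgroup2 H -> H h ->
  H (n%:~R * h.1, n%:~R * h.2).
Proof.
move=> [H0 HB] Hh.
have HN k : H k -> H (- k.1, - k.2).
  by move=> Hk; rewrite -[- k.1]add0r -[- k.2]add0r; apply: (HB (0, 0)).
have Hn (m : nat) : H (m%:R * h.1, m%:R * h.2).
  elim: m => [|m IH]; first by rewrite !mul0r.
  have := HB _ (- h.1, - h.2) IH (HN _ Hh).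
  by rewrite /= !opprK -natr1 !mulrDl !mul1r.
case: n => m; first exact: Hn.
by rewrite NegzE mulrNz !mulNr; apply: (HN (_, _)); apply: Hn.
Qed.

Lemma archi_inv e : 0 < e ->
  exists N : nat, forall n : nat, (N <= n)%N -> n.+1%:R^-1 < e.
Proof.
move=> e0; exists (Num.truncn e^-1) => n le.
rewrite -[ltRHS]invrK ltf_pV2 ?posrE ?ltr0n ?invr_gt0 //.
by apply: (lt_le_trans (truncnS_gt _)); rewrite ler_nat.
Qed.

(** The slopes of ever smaller elements that are closer to the horizontal than
to the vertical axis stay in [[-1, 1]] and accumulate at some [a]; integer
multiples of these elements then approximate the whole line of slope [a]. *)
Lemma subgroup2_line H : subgroup2 H -> closed2 H ->
  (forall e, 0 < e -> exists h, [/\ H h, h.1 != 0, `|h.1| < e & `|h.2| <= `|h.1|]) ->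
  exists a, forall t, H (t, a * t).
Proof.
move=> sH cH small.
have /choice[s hs] : forall n : nat, exists h,
    [/\ H h, h.1 != 0, `|h.1| < n.+1%:R^-1 & `|h.2| <= `|h.1|].
  by move=> n; apply: small; rewrite invr_gt0 ltr0n.
pose sl n := (s n).2 / (s n).1.
have sl1 n : sl n \in `[-1, 1].
  have [_ h0 _ h1] := hs n; rewrite in_itv /= -ler_norml normrM normfV.
  by rewrite ler_pdivrMr ?normr_gt0 // mul1r.
have [a [_ cl]] : [set` `[-1, 1 : R]] `&` cluster (sl @ \oo) !=set0.
  by apply: (@segment_compact R (-1) 1 (sl @ \oo)); exists 0%N => //= n _; exact: sl1.
have cla e : 0 < e -> exists h,
    [/\ H h, h.1 != 0, `|h.1| < e & `|h.2 / h.1 - a| < e].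
  move=> e0; have [N hN] := archi_inv e0.
  have /= := cl [set x | exists2 n, (N <= n)%N & x = sl n] (ball a e).
  case.
  - by exists N => //= n le; exists n.
  - exact: nbhsx_ballx.
  move=> _ /= [[n le ->] hb]; have [? ? h2 _] := hs n; exists (s n); split => //.
    exact: lt_trans h2 (hN _ le).
  by rewrite distrC.
exists a => t; apply: cH => e e0 /=.
(* The floor of [t / h.1], as a multiple of a small [h] of slope close to [a],
   is off by at most [`|h.1|] horizontally; [C] bounds the loss that the slopes
   cause vertically. *)
pose C := `|t| + `|a| + 2.
have C2 : 2 <= C by rewrite /C lerDr addr_ge0.
have Cp : 0 < C by apply: lt_le_trans C2.
have [|h [Hh h0 h1 h2]] := cla (Num.min (e / C) 1).
  by rewrite lt_min ltr01 divr_gt0.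
move: h1 h2; rewrite !lt_min => /andP[h1 h1'] /andP[h2 h2'].
set n := Num.floor (t / h.1).
have E1 : t - n%:~R * h.1 = frac (t / h.1) * h.1 by rewrite /frac mulrBl divfK.
have b1 : `|t - n%:~R * h.1| <= `|h.1|.
  rewrite E1 normrM ger0_norm ?frac_ge0 //.
  by rewrite ler_piMl // ltW // frac_lt1.
have eC : e / C < e by rewrite ltr_pdivrMr // ltr_pMr //; lra.
exists (n%:~R * h.1, n%:~R * h.2); split => /=; first exact: subgroup2_int.
  by apply: le_lt_trans b1 (lt_trans h1 eC).
set d := h.2 / h.1 - a in h2 h2'.
have -> : a * t - n%:~R * h.2 = a * (t - n%:~R * h.1) - d * (n%:~R * h.1).
  by rewrite /d mulrBl [h.2 / h.1 * _]mulrCA (divfK h0); ring.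
apply: (le_lt_trans (ler_normB _ _)); rewrite !normrM -[`|n%:~R| * _]normrM.
have b2 : `|n%:~R * h.1| <= `|t| + 1.
  have -> : n%:~R * h.1 = t - (t - n%:~R * h.1) by ring.
  apply: (le_trans (ler_normB _ _)); rewrite lerD2l; apply: le_trans b1 _.
  exact: ltW.
have : `|a| * `|t - n%:~R * h.1| <= `|a| * (e / C).
  by rewrite ler_wpM2l // (le_trans b1) // ltW.
have : `|d| * `|n%:~R * h.1| <= e / C * (`|t| + 1).
  by apply: ler_pM => //; exact: ltW.
have Ee : e = e / C * (`|t| + 1) + `|a| * (e / C) + e / C.
  by rewrite -[LHS](divfK (lt0r_neq0 Cp)) /C; ring.
have : 0 < e / C by rewrite divr_gt0.
lra.
Qed.

(** Once [H] contains a line of slope [a], it is determined by its vertical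
elements.  These include [1], [a] and [y - a * x]; if [a] and [y - a * x] were
both rational, [1], [x] and [y] would be dependent. *)
Lemma subgroup2_horizontal H x y : subgroup2 H -> closed2 H ->
  H (1, 0) -> H (0, 1) -> H (x, y) ->
  (forall p q r : rat, ratr p + ratr q * x + ratr r * y = 0 -> r = 0) ->
  (forall e, 0 < e -> exists h, [/\ H h, h.1 != 0, `|h.1| < e & `|h.2| <= `|h.1|]) ->
  forall h, H h.
Proof.
move=> sH cH H10 H01 Hxy ind small h.
have [a Ha] := subgroup2_line sH cH small.
pose K z := H (0, z).
have sK : subgroup1 K.
  split; first exact: sH.1.
  by move=> u w Ku Kw; have := sH.2 _ _ Ku Kw; rewrite /= subr0.
have cK : closed1 K.
  move=> u hu; apply: cH => e e0 /=; have [w Kw uw] := hu e e0.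
  by exists (0, w); split => //=; rewrite subrr normr0.
have Ka : K a by have := sH.2 _ _ (Ha 1) H10; rewrite /= subrr mulr1 subr0.
have Kb : K (y - a * x) by have := sH.2 _ _ Hxy (Ha x); rewrite /= subrr.
have Kall : forall z, K z.
  case: (pselect (irrational a)) => [ia|].
    exact: (subgroup1_irrational sK cK H01 Ka).
  move=> /existsNP[q /contrapT aq].
  apply: (subgroup1_irrational sK cK H01 Kb) => r hr.
  suff : (1 : rat) = 0 by move/eqP; rewrite oner_eq0.
  apply: (ind (- r) (- q) 1); rewrite !rmorphN rmorph1 /= -aq -hr; ring.
have := sH.2 _ _ (Ha h.1) (Kall (a * h.1 - h.2)) => /=.
by rewrite subr0 opprB addrC subrK; case: h.
Qed.

(** Dirichlet's theorem yields arbitrarily small elements with both coordinates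
nonzero.  Either arbitrarily small ones are closer to the horizontal axis, or
all the small ones are closer to the vertical axis, and then the coordinates are
exchanged. *)
Lemma subgroup2_full H x y : subgroup2 H -> closed2 H ->
  H (1, 0) -> H (0, 1) -> H (x, y) ->
  (forall p q r : rat, ratr p + ratr q * x + ratr r * y = 0 -> q = 0 /\ r = 0) ->
  forall h, H h.
Proof.
move=> sH cH H10 H01 Hxy ind.
have small e : 0 < e -> exists h,
    [/\ H h, h.1 != 0, h.2 != 0, `|h.1| < e & `|h.2| < e].
  move=> e0; have [N hN] := archi_inv e0.
  have [n [p [q [n0 hp hq]]]] := dirichlet x y (ltn0Sn N).
  have nZ : (n%:R : rat) != 0 by rewrite pnatr_eq0 -lt0n.
  exists (n%:R * x - p%:~R, n%:R * y - q%:~R); split => /=; last 2 first.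
  - exact: lt_trans hp (hN _ _).
  - exact: lt_trans hq (hN _ _).
  - have := sH.2 _ _ (sH.2 _ _ (subgroup2_int n sH Hxy) (subgroup2_int p sH H10))
      (subgroup2_int q sH H01).
    by rewrite /= !mulr0 !mulr1 !subr0.
  - apply/eqP => h0; have [] := ind (- p%:~R) n%:R 0.
      by rewrite rmorphN /= ratr_int ratr_nat rmorph0 mul0r addr0 addrC.
    by move/eqP; rewrite (negPf nZ).
  - apply/eqP => h0; have [] := ind (- q%:~R) 0 n%:R.
      by rewrite rmorphN /= ratr_int ratr_nat rmorph0 mul0r addr0 addrC.
    by move=> _ /eqP; rewrite (negPf nZ).
case: (pselect (forall e, 0 < e -> exists h,
    [/\ H h, h.1 != 0, `|h.1| < e & `|h.2| <= `|h.1|])).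
  by apply: (subgroup2_horizontal (x:=x) (y:=y)) => // p q r /ind[].
move=> /existsNP[e1 /not_implyP[e10 no]].
pose H' (h : R * R) := H (h.2, h.1).
suff H'all : forall h, H' h by move=> [h1 h2]; exact: (H'all (h2, h1)).
apply: (subgroup2_horizontal (x:=y) (y:=x)) => //.
- by split; [exact: sH.1 | move=> h k Hh Hk; exact: (sH.2 _ _ Hh Hk)].
- move=> h hh; apply: cH => e e0 /=; have [[k1 k2] [Hk h1 h2]] := hh e e0.
  by exists (k2, k1).
- by move=> p q r hh; have [] := ind p r q; first by rewrite addrAC.
move=> e e0.
have [|[h1 h2] [/= Hh h10 h20 lt1 lt2]] := small (Num.min e e1).
  by rewrite lt_min e0.
move: lt1 lt2; rewrite !lt_min => /andP[l1 l1'] /andP[l2 l2'].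
exists (h2, h1); split => //=.
case: (leP `|h1| `|h2|) => // lt; case: no; exists (h1, h2); split => //=; exact: ltW.
Qed.

End Kronecker.

(** * Subsets of the line with the same measure in all windows of equal length *)

Section Measure.
Variable R : realType.
Implicit Types (x y a b t e : R).
Local Notation lam := (@lebesgue_measure R).
Local Notation T1 := (measurableTypeR R).
Local Notation mu2 := (lam \x lam)%E.
Local Notation T2 := (measurableTypeR R * measurableTypeR R)%type.

(** Comparing [f (N * a)] with [f] at the neighbouring integers shows that
[f a] and [a * f 1] differ by at most [f 1 / N], for every [N]. *)
Lemma additive_linear (f : R -> R) :
  (forall a, 0 < a -> 0 <= f a) ->
  (forall a b, 0 < a -> 0 < b -> f (a + b) = f a + f b) ->
  forall a, 0 < a -> f a = a * f 1.
Proof.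
move=> f0 fD.
have f_le a b : 0 < a -> a <= b -> f a <= f b.
  move=> a0; rewrite le_eqVlt => /orP[/eqP->//|ab].
  by rewrite -[b](subrK a) addrC fD ?subr_gt0 // lerDl f0 ?subr_gt0.
have fM (n : nat) a : 0 < a -> f (n.+1%:R * a) = n.+1%:R * f a.
  move=> a0; elim: n => [|n IH]; first by rewrite !mul1r.
  by rewrite -natr1 !mulrDl !mul1r fD ?IH // mulr_gt0 ?ltr0n.
move=> a a0.
have f1 : 0 <= f 1 by apply: f0.
have bound n : `|f a - a * f 1| <= f 1 / n.+1%:R.
  have N0 : (0 : R) < n.+1%:R by rewrite ltr0n.
  have Na0 : 0 < n.+1%:R * a by rewrite mulr_gt0.
  rewrite ler_pdivlMr // mulrC -[X in X * _]gtr0_norm // -normrM mulrBr -fM // mulrA.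
  have /andP[m1 m2] := truncn_itv (ltW Na0).
  set m := Num.truncn _ in m1 m2.
  have h1 : f (n.+1%:R * a) <= m.+1%:R * f 1.
    by rewrite -fM // mulr1; apply: f_le => //; exact: ltW.
  have h2 : m%:R * f 1 <= f (n.+1%:R * a).
    case: m {h1 m2} m1 => [|m] m1; first by rewrite mul0r f0.
    by rewrite -fM // mulr1; apply: f_le => //; rewrite ltr0n.
  have h3 : m%:R * f 1 <= n.+1%:R * a * f 1 by rewrite ler_wpM2r.
  have h4 : n.+1%:R * a * f 1 <= m.+1%:R * f 1 by rewrite ler_wpM2r // ltW.
  move: h1 h4; rewrite -[m.+1%:R]natr1 mulrDl mul1r => h1 h4.
  by rewrite ler_norml; apply/andP; split; lra.
apply/eqP; rewrite -subr_eq0 -normr_le0; apply/ler_addgt0Pr => e e0; rewrite add0r.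
have f1p : 0 < f 1 + 1 by lra.
have [N hN] := archi_inv (divr_gt0 e0 f1p).
apply: (le_trans (bound N)).
apply: (@le_trans _ _ ((f 1 + 1) * (e / (f 1 + 1)))); last by rewrite mulrC divfK ?gt_eqF.
apply: ler_pM => //; first lra.
exact: ltW (hN _ _).
Qed.

Lemma additive_bilinear (f : R -> R -> R) :
  (forall a b, 0 <= f a b) ->
  (forall a a' b, 0 < a -> 0 < a' -> 0 < b -> f (a + a') b = f a b + f a' b) ->
  (forall a b b', 0 < a -> 0 < b -> 0 < b' -> f a (b + b') = f a b + f a b') ->
  forall a b, 0 < a -> 0 < b -> f a b = f 1 1 * (a * b).
Proof.
move=> f0 fDl fDr a b a0 b0.
rewrite (additive_linear (f := f ^~ b)) // => [|u w u0 w0]; last exact: fDl.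
rewrite (additive_linear (f := f 1)) // => [|u w u0 w0]; last exact: fDr.
by rewrite mulrA mulrC.
Qed.

Lemma measurable_shift h : measurable_fun setT ((fun x => x + h) : T1 -> T1).
Proof. exact: measurable_funD. Qed.

Lemma lebesgue_shift h (A : set T1) : measurable A ->
  lam ((fun x => x + h) @^-1` A) = lam A.
Proof.
move=> mA; have mS := measurable_shift h.
symmetry; apply: (@lebesgue_measure_unique R (pushforward lam
  ((fun x => x + h) : T1 -> T1))) => // _ [[a b]] _ <-.
rewrite [RHS](_ : _ = lam `]a - h, b - h]); last first.
  by congr (lam _); apply/seteqP; split => x /=; rewrite !in_itv /= ltrBlDr lerBrDr.
rewrite !lebesgue_measure_itv /= !lte_fin ltrD2r -!EFinB.
by congr (if _ then _%:E else _); ring.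
Qed.

Definition shift2 h k (p : T2) : T2 := (p.1 + h, p.2 + k).

Lemma leb2_shift h k (E : set T2) : measurable E ->
  mu2 (shift2 h k @^-1` E) = mu2 E.
Proof.
move=> mE.
have ms : measurable_fun setT (shift2 h k).
  by apply: measurable_fun_pair; apply: (measurableT_comp (measurable_shift _));
    [exact: measurable_fst | exact: measurable_snd].
symmetry.
apply: (@product_measure_unique _ _ _ _ R lam lam (pushforward mu2 (shift2 h k))) => //.
move=> A B mA mB.
have mS u C : measurable C -> measurable ((fun x : T1 => x + u : T1) @^-1` C).
  by move=> mC; rewrite -[X in measurable X]setTI; exact: (measurable_shift u).
transitivity (mu2 (((fun x => x + h) @^-1` A) `*` ((fun x => x + k) @^-1` B))) => //.
rewrite product_measure1E; [|exact: (mS h A mA) | exact: (mS k B mB)].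
by congr (_ * _)%E; apply: lebesgue_shift.
Qed.

(** Covering the line by windows settles [c = 0]; otherwise [nu / c] is Lebesgue
measure, which is characterized by its values on half-open intervals. *)
Lemma uniform_measure (nu : {measure set T1 -> \bar R}) (c : R) :
  0 <= c -> (forall x a, 0 < a -> nu `]x, x + a]%classic = (c * a)%:E) ->
  forall A, measurable A -> nu A = (c%:E * lam A)%E.
Proof.
move=> c0 nuI A mA.
have oc X : ocitv X -> nu X = (c%:E * lam X)%E.
  move=> [[x y] _ <-] /=; rewrite lebesgue_measure_itv /= lte_fin.
  case: ifPn => [xy|].
    by rewrite -EFinB -EFinM -(nuI x) ?subr_gt0 // addrC subrK.
  rewrite -leNgt => yx; rewrite set_itv_ge ?measure0 ?mule0 //.
  by rewrite bnd_simp -leNgt.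
have := c0; rewrite le_eqVlt => /orP[/eqP c00|cp].
  rewrite -c00 mul0e; apply/eqP; rewrite eq_le measure_ge0 andbT.
  pose J n : set T1 := `](- n%:R : R), (- n%:R + (n%:R *+ 2 + 1))%R]%classic.
  have : nu.-negligible (\bigcup_n J n).
    apply: negligible_bigcup => n; exists (J n).
    split => //; first exact: measurable_itv.
    rewrite /J nuI; first by rewrite -c00 mul0r.
    by rewrite ltr_wpDl // mulrn_wge0.
  move=> [Z [mZ Z0 sub]]; rewrite -Z0; apply: le_measure; rewrite ?inE //.
  move=> z _; apply: sub; exists (Num.truncn `|z|).+1 => //=.
  have := truncnS_gt `|z|; rewrite /J /= ltr_norml in_itv /= => /andP[h1 h2].
  by apply/andP; split; lra.
have cV : 0 <= c^-1 by rewrite invr_ge0.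
have /(_ _ A mA) -> := @lebesgue_measure_unique R (mscale (NngNum cV) nu).
  by rewrite /mscale /= muleA -EFinM mulfV ?gt_eqF // mul1e.
move=> X oX; transitivity ((c^-1)%:E * nu X)%E => //.
by rewrite oc // muleA -EFinM mulVf ?gt_eqF // mul1e.
Qed.

Lemma itv_diff_le x y a : (lam (`]x, (x + a)%R] `\` `]y, (y + a)%R]) <= `|x - y|%:E)%E.
Proof.
have [xy|yx] := leP x y.
  apply: (@le_trans _ _ (lam `]x, y]%classic)).
    apply: le_measure; rewrite ?inE //; first exact: measurableD.
    move=> z /=; rewrite !in_itv /= => -[/andP[h1 h2] /negP]; rewrite negb_and.
    rewrite h1 -!leNgt /= -ltNge => /orP[//|]; lra.
  rewrite lebesgue_measure_itv /= lte_fin distrC ger0_norm ?subr_ge0 //.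
  by case: ifPn => _; rewrite -?EFinB // lee_fin subr_ge0.
apply: (@le_trans _ _ (lam `](y + a)%R, (x + a)%R]%classic)).
  apply: le_measure; rewrite ?inE //; first exact: measurableD.
  move=> z /=; rewrite !in_itv /= => -[/andP[h1 h2] /negP]; rewrite negb_and.
  rewrite h2 andbT -!leNgt -ltNge => /orP[|//]; lra.
rewrite lebesgue_measure_itv /= lte_fin ltrD2r yx -EFinB gtr0_norm ?subr_gt0 //.
by rewrite lee_fin; lra.
Qed.

Definition window1 (F : set T1) (a x : R) : R :=
  fine (lam (F `&` `]x, (x + a)%R])).

Lemma window1_fin F a x : measurable F -> 0 <= a ->
  (lam (F `&` `]x, (x + a)%R]) <= a%:E)%E.
Proof.
move=> mF a0; apply: (@le_trans _ _ (lam `]x, (x + a)%R]%classic)).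
  by apply: le_measure; rewrite ?inE //; exact: measurableI.
rewrite lebesgue_measure_itv /= lte_fin; case: ifPn => _ //.
by rewrite -EFinB lee_fin; lra.
Qed.

Lemma window1E F a x : measurable F -> 0 <= a ->
  lam (F `&` `]x, (x + a)%R]) = (window1 F a x)%:E.
Proof.
move=> mF a0; rewrite /window1 fineK // ge0_fin_numE //.
exact: le_lt_trans (window1_fin _ mF a0) (ltry _).
Qed.

Lemma window1_le F a x : measurable F -> 0 <= a -> 0 <= window1 F a x <= a.
Proof.
move=> mF a0; rewrite -!lee_fin -window1E // window1_fin // andbT.
exact: measure_ge0.
Qed.

Lemma measure_diff_le d (T : measurableType d) (mu : {measure set T -> \bar R})
    (E Q Q' : set T) :
  measurable E -> measurable Q -> measurable Q' ->
  (mu (E `&` Q) <= mu (E `&` Q') + mu (Q `\` Q'))%E.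
Proof.
move=> mE mQ mQ'; apply: le_trans (measureU2 _ _ _).
- apply: le_measure; rewrite ?inE; first exact: measurableI.
    by apply: measurableU; [exact: measurableI | exact: measurableD].
  by move=> x [Ex Qx]; case: (pselect (Q' x)) => h; [left | right].
- exact: measurableI.
- exact: measurableD.
Qed.

Lemma window1_lip F a x y : measurable F -> 0 <= a ->
  `|window1 F a x - window1 F a y| <= `|x - y|.
Proof.
move=> mF a0.
have W u w : window1 F a u <= window1 F a w + `|u - w|.
  rewrite -lee_fin EFinD -!window1E //.
  have le := @measure_diff_le _ _ lam F `]u, (u + a)%R]%classic
    `]w, (w + a)%R]%classic mF.
  apply: (le_trans (le _ _)) => //.
  by rewrite leeD2l // itv_diff_le.
have := W x y; have := W y x; rewrite distrC => h1 h2.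
by rewrite ler_norml; apply/andP; split; lra.
Qed.

Lemma itv_split x a b : 0 <= a -> 0 <= b ->
  `]x, (x + (a + b))%R]%classic =
  `]x, (x + a)%R]%classic `|` `](x + a)%R, (x + a + b)%R]%classic.
Proof.
move=> a0 b0; apply/seteqP; split => z /=; rewrite !in_itv /= addrA.
  by move=> /andP[-> h]; case: (leP z (x + a)) => _; [left | right].
by move=> [/andP[h1 h2]|/andP[h1 h2]]; apply/andP; split => //; lra.
Qed.

Lemma itv_disj x a b z :
  `]x, (x + a)%R]%classic z -> `](x + a)%R, (x + a + b)%R]%classic z -> False.
Proof. by rewrite /= !in_itv /= => /andP[h1 h2] /andP[h3 h4]; lra. Qed.

Lemma window1D F a b x : measurable F -> 0 <= a -> 0 <= b ->
  window1 F (a + b) x = window1 F a x + window1 F b (x + a).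
Proof.
move=> mF a0 b0; apply: EFin_inj; rewrite EFinD -!window1E ?addr_ge0 //.
rewrite itv_split // setIUr measureU //.
- exact: measurableI.
- exact: measurableI.
by apply/seteqP; split => z //= [[_ h1] [_ h2]]; exact: itv_disj h1 h2.
Qed.

Lemma window1_shift (F : set T1) d h z : measurable F -> 0 <= d ->
  window1 F d (z + h) = window1 ((fun y => y + h) @^-1` F) d z.
Proof.
move=> mF d0; rewrite /window1 -(@lebesgue_shift h); last by apply: measurableI.
congr (fine (lam _)); apply/seteqP; split => y /= [?];
  rewrite !in_itv /= => /andP[? ?].
  by split => //; apply/andP; split; lra.
by split => //; apply/andP; split; lra.
Qed.

Lemma window1_lip_length (F : set T1) d d' z : measurable F -> 0 <= d -> 0 <= d' ->
  `|window1 F d z - window1 F d' z| <= `|d - d'|.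
Proof.
move=> mF; wlog dd' : d d' / d <= d'.
  move=> W d0 d0'; have [h|/ltW h] := leP d d'; first exact: W.
  by rewrite distrC [leRHS]distrC; apply: W.
move=> d0 d0'.
have c0 : 0 <= d' - d by rewrite subr_ge0.
have := window1D z mF d0 c0; rewrite [d + (d' - d)]addrC subrK => ->.
have /andP[h1 h2] := window1_le (z + d) mF c0.
by rewrite opprD addrA subrr add0r normrN ger0_norm // distrC ger0_norm.
Qed.

(** The measure of [F] in a window is a constant [c] times the length, so the
trace of Lebesgue measure on [F] is [c] times Lebesgue measure.  If [c] is not
0, evaluate both on the complement of [F]. *)
Lemma zero_one1 F : measurable F ->
  (forall a x y, 0 < a -> window1 F a x = window1 F a y) ->
  lam F = 0%E \/ lam (~` F) = 0%E.
Proof.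
move=> mF Wc.
pose c := window1 F 1 0.
have c0 : 0 <= c by have /andP[] := @window1_le F 1 0 mF ler01.
have Wlin x a : 0 < a -> window1 F a x = c * a.
  move=> a0; rewrite (Wc _ _ 0) // mulrC.
  apply: (additive_linear (f := fun a => window1 F a 0)) => // [u u0|u w u0 w0].
    by have /andP[] := @window1_le F u 0 mF (ltW u0).
  by rewrite window1D ?(ltW u0) ?(ltW w0) // (Wc w _ 0).
have U A : measurable A -> lam (F `&` A) = (c%:E * lam A)%E.
  move=> mA; rewrite setIC; apply: (@uniform_measure (mrestr lam mF) c c0) => // x a a0.
  transitivity (lam (`]x, (x + a)%R] `&` F)) => //.
  by rewrite setIC window1E ?(ltW a0) // Wlin.
have := c0; rewrite le_eqVlt => /orP[/eqP c00|cp].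
  by left; have := U F mF; rewrite setIid -c00 mul0e.
right; have := U (~` F) (measurableC mF); rewrite setICr measure0 => /eqP.
by rewrite eq_sym mule_eq0 eqe gt_eqF //= => /eqP.
Qed.

End Measure.

(** * Ergodicity of the irrational translations of the torus of dimension 2 *)

Section Measure2.
Variable R : realType.
Implicit Types (x y a b t e : R).
Local Notation lam := (@lebesgue_measure R).
Local Notation T1 := (measurableTypeR R).
Local Notation mu2 := (lam \x lam)%E.
Local Notation T2 := (measurableTypeR R * measurableTypeR R)%type.
Implicit Types (E : set T2) (p : T2).

Definition box a b p : set T2 :=
  `]p.1, (p.1 + a)%R]%classic `*` `]p.2, (p.2 + b)%R]%classic.

Definition window2 E a b p : R := fine (mu2 (E `&` box a b p)).

Lemma measurable_box a b p : measurable (box a b p).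
Proof. by apply: measurableX; exact: measurable_itv. Qed.

Lemma lam_window x a : 0 <= a -> lam `]x, (x + a)%R]%classic = a%:E.
Proof.
rewrite le_eqVlt => /orP[/eqP <-|a0].
  by rewrite set_itv_ge ?measure0 // bnd_simp addr0 ltxx.
by rewrite lebesgue_measure_itv /= lte_fin ltrDl a0 -EFinB addrAC subrr add0r.
Qed.

Lemma mu2_box a b p : 0 <= a -> 0 <= b -> mu2 (box a b p) = (a * b)%:E.
Proof.
move=> a0 b0; rewrite product_measure1E; [|exact: measurable_itv | exact: measurable_itv].
by rewrite EFinM; congr (_ * _)%E; apply: lam_window.
Qed.

Lemma window2_fin E a b p : measurable E -> 0 <= a -> 0 <= b ->
  (mu2 (E `&` box a b p) <= (a * b)%:E)%E.
Proof.
move=> mE a0 b0; rewrite -(mu2_box p a0 b0); apply: le_measure; rewrite ?inE //.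
  by apply: measurableI => //; exact: measurable_box.
exact: measurable_box.
Qed.

Lemma window2E E a b p : measurable E -> 0 <= a -> 0 <= b ->
  mu2 (E `&` box a b p) = (window2 E a b p)%:E.
Proof.
move=> mE a0 b0; rewrite /window2 fineK // ge0_fin_numE ?measure_ge0 //.
exact: le_lt_trans (window2_fin _ mE a0 b0) (ltry _).
Qed.

Lemma window2_ge0 E a b p : 0 <= window2 E a b p.
Proof. by apply: fine_ge0; exact: measure_ge0. Qed.

Lemma norm_sub_le (r s t : R) : r <= s + t -> s <= r + t -> `|r - s| <= t.
Proof. by move=> h1 h2; rewrite ler_norml; apply/andP; split; lra. Qed.

Lemma window2_lip E a b p q : measurable E -> 0 <= a -> 0 <= b ->
  `|window2 E a b p - window2 E a b q| <= `|p.1 - q.1| * b + a * `|p.2 - q.2|.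
Proof.
move=> mE a0 b0.
have W u w : window2 E a b u <= window2 E a b w + (`|u.1 - w.1| * b + a * `|u.2 - w.2|).
  have : (mu2 (E `&` box a b u) <= mu2 (E `&` box a b w) +
      (`|u.1 - w.1| * b + a * `|u.2 - w.2|)%:E)%E; last first.
    by rewrite (window2E u) // (window2E w) // -EFinD lee_fin.
  have le := @measure_diff_le R _ _ mu2 E (box a b u) (box a b w) mE
    (measurable_box _ _ _) (measurable_box _ _ _).
  apply: (le_trans le); rewrite leeD2l //.
  (* The first box exceeds the second one by a vertical and a horizontal strip. *)
  pose I (z : T2) : set T1 := `]z.1, (z.1 + a)%R]%classic.
  pose J (z : T2) : set T1 := `]z.2, (z.2 + b)%R]%classic.
  have mI z : measurable (I z) by exact: measurable_itv.
  have mJ z : measurable (J z) by exact: measurable_itv.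
  apply: (@le_trans _ _ (mu2 (((I u `\` I w) `*` J u) `|` (I u `*` (J u `\` J w))))).
    apply: le_measure; rewrite ?inE.
    - by apply: measurableD; exact: measurable_box.
    - by apply: measurableU; apply: measurableX => //; exact: measurableD.
    move=> z [[Iz Jz] no]; case: (pselect (I w z.1)) => h; last by left.
    by right; split => //; split => // h'; apply: no.
  apply: (le_trans (measureU2 _ _ _)); rewrite ?EFinD.
  - by apply: measurableX => //; exact: measurableD.
  - by apply: measurableX => //; exact: measurableD.
  apply: leeD.
    suff : (mu2 ((I u `\` I w) `*` J u) <= (`|u.1 - w.1| * b)%:E)%E by [].
    rewrite product_measure1E //; last exact: measurableD.
    rewrite EFinM; apply: lee_pmul => //; first exact: itv_diff_le.
    by rewrite le_eqVlt; apply/orP; left; apply/eqP; exact: lam_window.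
  suff : (mu2 (I u `*` (J u `\` J w)) <= (a * `|u.2 - w.2|)%:E)%E by [].
  rewrite product_measure1E //; last exact: measurableD.
  rewrite EFinM; apply: lee_pmul => //; last exact: itv_diff_le.
  by rewrite le_eqVlt; apply/orP; left; apply/eqP; exact: lam_window.
apply: norm_sub_le; first exact: W.
by rewrite (distrC p.1) (distrC p.2); exact: W.
Qed.

Lemma window2Dl E a a' b p : measurable E -> 0 <= a -> 0 <= a' -> 0 <= b ->
  window2 E (a + a') b p = window2 E a b p + window2 E a' b (p.1 + a, p.2).
Proof.
move=> mE a0 a0' b0.
suff : (mu2 (E `&` box (a + a') b p) =
    mu2 (E `&` box a b p) + mu2 (E `&` box a' b ((p.1 + a)%R, p.2)))%E.
  by move=> H; apply: EFin_inj; move: H; rewrite !window2E ?addr_ge0 // -EFinD.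
have -> : box (a + a') b p = box a b p `|` box a' b (p.1 + a, p.2).
  rewrite /box /= itv_split //; apply/seteqP; split => z.
    by move=> [[?|?] ?]; [left | right].
  by move=> [[? ?]|[? ?]]; split => //; [left | right].
rewrite setIUr measureU //.
- by apply: measurableI => //; exact: measurable_box.
- by apply: measurableI => //; exact: (@measurable_box a' b (p.1 + a, p.2)).
apply/seteqP; split => z //= [[_ [h1 _]] [_ [h2 _]]].
exact: itv_disj h1 h2.
Qed.

Lemma window2Dr E a b b' p : measurable E -> 0 <= a -> 0 <= b -> 0 <= b' ->
  window2 E a (b + b') p = window2 E a b p + window2 E a b' (p.1, p.2 + b).
Proof.
move=> mE a0 b0 b0'.
suff : (mu2 (E `&` box a (b + b') p) =
    mu2 (E `&` box a b p) + mu2 (E `&` box a b' (p.1, (p.2 + b)%R)))%E.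
  by move=> H; apply: EFin_inj; move: H; rewrite !window2E ?addr_ge0 // -EFinD.
have -> : box a (b + b') p = box a b p `|` box a b' (p.1, p.2 + b).
  rewrite /box /= itv_split //; apply/seteqP; split => z.
    by move=> [? [?|?]]; [left | right].
  by move=> [[? ?]|[? ?]]; split => //; [left | right].
rewrite setIUr measureU //.
- by apply: measurableI => //; exact: measurable_box.
- by apply: measurableI => //; exact: (@measurable_box a b' (p.1, p.2 + b)).
apply/seteqP; split => z //= [[_ [_ h1]] [_ [_ h2]]].
exact: itv_disj h1 h2.
Qed.

(** [uniform_measure] in one coordinate at a time.  The first set must have
finite measure, since the constant for the second coordinate is [c * r]. *)
Lemma proportional_rectangle E c : measurable E -> 0 <= c ->
  (forall a b p, 0 < a -> 0 < b -> window2 E a b p = c * (a * b)) ->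
  forall A B r, measurable A -> measurable B -> 0 <= r -> lam A = r%:E ->
  mu2 (E `&` (A `*` B)) = ((c * r)%:E * lam B)%E.
Proof.
move=> mE c0 Wc A B r mA mB r0 Ar.
have mH (J : set T1) : measurable J -> measurable (E `&` ([set: T1] `*` J)).
  by move=> mJ; apply: measurableI => //; apply: measurableX.
have mV (I : set T1) : measurable I -> measurable (E `&` (I `*` [set: T1])).
  by move=> mI; apply: measurableI => //; apply: measurableX.
have step1 y b : 0 < b -> forall C, measurable C ->
    mu2 (E `&` (C `*` `]y, (y + b)%R]%classic)) = ((c * b)%:E * lam C)%E.
  move=> b0 C mC.
  have mJ : measurable (`]y, (y + b)%R]%classic : set T1) by exact: measurable_itv.
  have mfst : measurable_fun setT (@fst T1 T1) by exact: measurable_fst.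
  rewrite -(@uniform_measure R (pushforward (mrestr mu2 (mH _ mJ)) (@fst T1 T1))
    (c * b)) //.
  - congr (mu2 _); apply/seteqP; split => z /=; first by move=> [? [? ?]].
    by move=> [? [? [_ ?]]].
  - by rewrite mulr_ge0 // ltW.
  move=> x a a0; transitivity (mu2 (E `&` box a b (x, y))).
    congr (mu2 _); apply/seteqP; split => z /=; last by move=> [? [? ?]].
    by move=> [? [? [_ ?]]].
  by rewrite window2E ?(ltW a0) ?(ltW b0) // Wc // mulrA mulrAC.
have msnd : measurable_fun setT (@snd T1 T1) by exact: measurable_snd.
rewrite -(@uniform_measure R (pushforward (mrestr mu2 (mV _ mA)) (@snd T1 T1))
  (c * r)) //.
- congr (mu2 _); apply/seteqP; split => z /=; first by move=> [? [? ?]].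
  by move=> [? [? [? _]]].
- exact: mulr_ge0.
move=> x a a0; transitivity (mu2 (E `&` (A `*` `]x, (x + a)%R]%classic))).
  congr (mu2 _); apply/seteqP; split => z /=; last by move=> [? [? ?]].
  by move=> [? [? [? _]]].
by rewrite step1 // Ar -EFinM mulrAC.
Qed.

(** If [c] is not 0, then on each square the trace of [mu2] on [E], divided by
[c], agrees with [mu2] on rectangles, hence on the complement of [E], where it
vanishes. *)
Lemma proportional_zero_one E c : measurable E -> 0 <= c ->
  (forall a b p, 0 < a -> 0 < b -> window2 E a b p = c * (a * b)) ->
  mu2 E = 0%E \/ mu2 (~` E) = 0%E.
Proof.
move=> mE c0 Wc.
pose o n : T2 := (- n%:R : R, - n%:R : R).
pose K n : set T2 := box (n%:R *+ 2 + 1) (n%:R *+ 2 + 1) (o n).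
have sz n : 0 < (n%:R *+ 2 + 1 : R) by rewrite ltr_wpDl // mulrn_wge0.
have cover F : measurable F -> (forall n, mu2 (F `&` K n) = 0%E) -> mu2 F = 0%E.
  move=> mF F0.
  have : mu2.-negligible (\bigcup_n (F `&` K n)).
    apply: negligible_bigcup => n; exists (F `&` K n); split => //; last exact: F0.
    by apply: measurableI => //; exact: measurable_box.
  move=> [Z [mZ Z0 sub]]; apply/eqP; rewrite eq_le measure_ge0 andbT -Z0.
  apply: le_measure; rewrite ?inE // => -[z1 z2] Fz; apply: sub.
  exists (Num.truncn `|z1| + Num.truncn `|z2|).+1 => //=; split => //=.
  set n := (_ + _).+1.
  have h1 : `|z1| < n%:R.
    by apply: (lt_le_trans (truncnS_gt _)); rewrite ler_nat ltnS leq_addr.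
  have h2 : `|z2| < n%:R.
    by apply: (lt_le_trans (truncnS_gt _)); rewrite ler_nat ltnS leq_addl.
  move: h1 h2; rewrite !ltr_norml => /andP[? ?] /andP[? ?].
  by rewrite /K /box /o; split => /=; rewrite in_itv /=; apply/andP; split; lra.
have := c0; rewrite le_eqVlt => /orP[/eqP c00|cp].
  left; apply: cover => // n; rewrite /K window2E ?ltW // Wc //.
  by rewrite -c00 mul0r.
right; apply: cover; first exact: measurableC.
move=> n.
pose I : set T1 := `](- n%:R : R), (- n%:R + (n%:R *+ 2 + 1))%R]%classic.
have mI : measurable I by exact: measurable_itv.
have Ioo : (lam I < +oo)%E by rewrite lam_window ?ltry // ltW.
pose lI := mfrestr mI Ioo.
have mK : measurable (K n) by exact: measurable_box.
have mEK : measurable (E `&` K n) by exact: measurableI.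
have KI : K n = I `*` I by [].
have cV : 0 <= c^-1 by rewrite invr_ge0.
have U1 := @product_measure_unique _ _ _ _ R lI lI (mrestr mu2 mK).
have U2 := @product_measure_unique _ _ _ _ R lI lI (mscale (NngNum cV) (mrestr mu2 mEK)).
transitivity (mrestr mu2 mK (~` E)) => //.
rewrite -U1; last exact: measurableC; last first.
  move=> A B mA mB; transitivity (mu2 ((A `*` B) `&` (K n))) => //.
  rewrite KI -setXI product_measure1E //; exact: measurableI.
rewrite U2; last exact: measurableC; last first.
  move=> A B mA mB; transitivity ((c^-1)%:E * mu2 ((A `*` B) `&` (E `&` (K n))))%E => //.
  rewrite KI setICA -setXI.
  have AIle : (lam (A `&` I) <= lam I)%E.
    by apply: le_measure; rewrite ?inE //; exact: measurableI.
  have AIfin : lam (A `&` I) \is a fin_num.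
    by rewrite ge0_fin_numE ?measure_ge0 //; exact: (le_lt_trans AIle Ioo).
  rewrite (@proportional_rectangle _ c mE c0 Wc _ _ (fine (lam (A `&` I)))).
  - by rewrite muleA -EFinM mulrA mulVf ?gt_eqF // mul1r fineK.
  - exact: measurableI.
  - exact: measurableI.
  - exact/fine_ge0/measure_ge0.
  - by rewrite fineK.
transitivity ((c^-1)%:E * mu2 ((~` E) `&` (E `&` (K n))))%E => //.
by rewrite setIA setICl set0I measure0 mule0.
Qed.

(** The set [H] of the periods of the box measures of [E] is a closed subgroup of
the plane, because these measures depend continuously on the box. *)
Theorem zero_one2 E x y : measurable E ->
  (forall p, E (shift2 1 0 p) <-> E p) -> (forall p, E (shift2 0 1 p) <-> E p) ->
  (forall p, E (shift2 x y p) <-> E p) ->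
  (forall p q r : rat, ratr p + ratr q * x + ratr r * y = 0 -> q = 0 /\ r = 0) ->
  mu2 E = 0%E \/ mu2 (~` E) = 0%E.
Proof.
move=> mE E1 E2 E3 ind.
pose H (h : R * R) := forall a b p, 0 < a -> 0 < b ->
  window2 E a b (shift2 h.1 h.2 p) = window2 E a b p.
have HE h k : (forall p, E (shift2 h k p) <-> E p) -> H (h, k).
  move=> inv a b p a0 b0; apply: (congr1 fine).
  rewrite -[LHS](@leb2_shift R h k) /=; last first.
    by apply: measurableI => //; exact: measurable_box.
  congr (mu2 _); apply/seteqP; split => z /= [Ez].
    move=> [/= i1 i2]; split; first by apply/inv.
    move: i1 i2; rewrite /box /= !in_itv /= => /andP[? ?] /andP[? ?].
    by split => /=; apply/andP; split; lra.
  move=> [/= i1 i2]; split; first by apply/(inv z).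
  move: i1 i2; rewrite /box /= !in_itv /= => /andP[? ?] /andP[? ?].
  by split => /=; apply/andP; split; lra.
have sH : subgroup2 H.
  split; first by move=> a b p _ _; rewrite /shift2 /= !addr0; case: p.
  move=> h k Hh Hk a b p a0 b0.
  apply: etrans (Hh a b p a0 b0).
  apply: etrans (esym (Hk a b (shift2 (h.1 - k.1) (h.2 - k.2) p) a0 b0)) _.
  apply: congr1; rewrite /shift2 /=.
  by rewrite -(addrA p.1) -(addrA p.2) !subrK.
have cH : closed2 H.
  move=> h hh a b p a0 b0; apply/eqP; rewrite -subr_eq0 -normr_le0.
  apply/ler_addgt0Pr => e e0; rewrite add0r.
  have ab : 0 < a + b by rewrite addr_gt0.
  have [k [Hk k1 k2]] := hh _ (divr_gt0 e0 ab).
  rewrite -(Hk a b p a0 b0).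
  apply: (le_trans (window2_lip _ _ mE (ltW a0) (ltW b0))) => /=.
  rewrite !opprD !(addrACA _ _ (- _)) !subrr !add0r.
  have -> : e = e / (a + b) * b + a * (e / (a + b)).
    by rewrite [a * _]mulrC -mulrDr [b + a]addrC divfK ?gt_eqF.
  by rewrite lerD // ?ler_wpM2r ?ler_wpM2l // ltW.
have Hall : forall h, H h.
  exact: (subgroup2_full sH cH (HE _ _ E1) (HE _ _ E2) (HE _ _ E3) ind).
have Wp a b p q : 0 < a -> 0 < b -> window2 E a b p = window2 E a b q.
  move=> a0 b0; apply: etrans (esym (Hall (q.1 - p.1, q.2 - p.2) a b p a0 b0)) _.
  apply: congr1.
  by rewrite /shift2 /= ![p.1 + _]addrC ![p.2 + _]addrC !subrK; case: q.
apply: (@proportional_zero_one E (window2 E 1 1 (0, 0)) mE (window2_ge0 _ _ _ _)).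
move=> a b p a0 b0; apply: etrans (Wp a b p (0, 0) a0 b0) _.
apply: (@additive_bilinear R (fun a b => window2 E a b (0, 0))) => //.
- by move=> u w; exact: window2_ge0.
- move=> u u' w u0 u0' w0; rewrite (window2Dl _ mE (ltW u0) (ltW u0') (ltW w0)).
  by apply: congr1; exact: Wp.
- move=> u w w' u0 w0 w0'; rewrite (window2Dr _ mE (ltW u0) (ltW w0) (ltW w0')).
  by apply: congr1; exact: Wp.
Qed.

End Measure2.

(** * Geodesics on the surface *)

Section RealAux.
Variable R : realType.

Lemma near0P (P : R -> Prop) : (\forall h \near (0 : R), P h) <->
  exists2 e, 0 < e & forall h, `|h| < e -> P h.
Proof.
split.
  move=> /nbhs_ballP[e e0 hP]; exists e => // h he; apply: hP.
  by rewrite /ball /= sub0r normrN.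
move=> [e e0 hP]; apply/nbhs_ballP; exists e => // h.
by rewrite /ball /= sub0r normrN; apply: hP.
Qed.

(** Consider the supremum of the times up to which [Q] holds throughout. *)
Lemma continuous_induction (Q : R -> Prop) : Q 0 ->
  (forall s, 0 <= s -> exists2 e, 0 < e & forall t t', 0 <= t ->
     s - e < t -> t <= t' -> t' < s + e -> Q t -> Q t') ->
  forall t, 0 <= t -> Q t.
Proof.
move=> Q0 loc t t0; apply: contrapT => nQ.
pose S := [set u : R | 0 <= u /\ forall w, 0 <= w <= u -> Q w].
have S0 : S 0 by split => // w h; have -> : w = 0 by lra.
have St u : S u -> u <= t.
  move=> [u0 hu]; rewrite leNgt; apply/negP => tu; apply: nQ; apply: hu.
  by rewrite t0 ltW.
have hS : has_sup S by split; [exists 0 | exists t => u; apply: St].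
have s0 : 0 <= sup S by apply: ub_le_sup => //; exact: hS.2.
have [e e0 he] := loc _ s0.
have [u [u0 hu] lu] := sup_adherent e0 hS.
have us : u <= sup S by apply: ub_le_sup; [exact: hS.2 | split].
have : S (sup S + e / 2).
  split; first by rewrite addr_ge0 // divr_ge0 // ltW.
  move=> w /andP[w0 w1]; have [wu|uw] := leP w u; first by apply: hu; rewrite w0.
  apply: (he u) => //; [exact: ltW | lra | by apply: hu; rewrite u0 lexx].
by move=> /(ub_le_sup hS.2); lra.
Qed.

Lemma fracDz (x : R) (n : int) : frac (x + n%:~R) = frac x.
Proof. by rewrite /frac floorDrz ?intr_int // intrKfloor rmorphD /=; ring. Qed.

Lemma frac_fracD (x y : R) : frac (frac x + y) = frac (x + y).
Proof.
by rewrite -[RHS](fracDz _ (- Num.floor x)) rmorphN /= {2}/frac addrAC.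
Qed.

Lemma floor_fracD (x y : R) : Num.floor (frac x + y) = Num.floor (x + y) - Num.floor x.
Proof.
rewrite /frac addrAC -rmorphN /= floorDrz ?intr_int // intrKfloor //.
Qed.

Lemma frac_id (x : R) : 0 <= x < 1 -> frac x = x.
Proof.
move=> h; rewrite /frac (_ : Num.floor x = 0) ?mulr0z ?subr0 //.
by apply: floor_def; rewrite add0r mulr0z mulr1z.
Qed.

Lemma frac_eq0 (x : R) : frac x = 0 -> x = (Num.floor x)%:~R.
Proof. by move/eqP; rewrite subr_eq0 => /eqP. Qed.

End RealAux.

Section Cross.
Variables (S : finType) (s : {perm S}).

Lemma crossS (m : int) i : cross s (m + 1) i = s (cross s m i).
Proof.
case: m => [n|[|n]]; first by rewrite -PoszD addn1.
  by rewrite /= permKV.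
have -> : Negz n.+1 + 1 = Negz n by rewrite !NegzE -[n.+2]addn1 PoszD opprD subrK.
by rewrite /= permKV.
Qed.

Lemma crossB1 (m : int) i : cross s (m - 1) i = (s^-1)%g (cross s m i).
Proof. by rewrite -[m in RHS](subrK 1) crossS permK. Qed.

Lemma crossD (m n : int) i : cross s m (cross s n i) = cross s (n + m) i.
Proof.
elim/int_ind: m => [|m IH|m IH]; first by rewrite addr0.
  by rewrite -addn1 PoszD crossS IH addrA crossS.
by rewrite -addn1 PoszD opprD crossB1 IH addrA crossB1.
Qed.

Lemma crossK (m : int) i : cross s m (cross s (- m) i) = i.
Proof. by rewrite crossD addNr. Qed.
End Cross.

Section Flow.
Variables (R : realType) (T : Type) (X sing : set T).
Implicit Types (move : R -> T -> T).

(** Rescaling time by a constant factor turns the unit speed flow into the flow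
along an unnormalized direction, with the same invariant sets. *)
Lemma flow_rescale move c t p q : 0 < c ->
  flow X sing (fun h => move (c * h)) t p q -> flow X sing move (c * t) p q.
Proof.
move=> c0 [t0 [g [geo g0 gt]]]; split; first by rewrite mulr_ge0 // ltW.
exists (fun s => g (c^-1 * s)); split; last 2 first.
- by rewrite mulr0.
- by rewrite mulKf ?gt_eqF.
move=> s /andP[s0 st].
have hs : 0 <= c^-1 * s <= t.
  by rewrite mulr_ge0 ?invr_ge0 ?(ltW c0) //= ler_pdivrMl.
have [Xg /near0P[e e0 he]] := geo _ hs; split => //.
apply/near0P; exists (c * e) => [|h hh hst]; first exact: mulr_gt0.
rewrite mulrDr he.
- by rewrite mulVKf ?gt_eqF.
- by rewrite normrM normfV (gtr0_norm c0) ltr_pdivrMl.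
rewrite -mulrDr; move: hst => /andP[? ?].
by rewrite mulr_ge0 ?invr_ge0 ?(ltW c0) //= ler_pdivrMl.
Qed.

Lemma invariant_rescale move c (A : set T) : 0 < c ->
  invariant_set (flow X sing (fun h => move (c * h))) A <->
  invariant_set (flow X sing move) A.
Proof.
move=> c0; split=> inv t p q F; last exact: (inv (c * t)) (flow_rescale c0 F).
apply: (inv (c^-1 * t)); apply: flow_rescale; first by rewrite invr_gt0.
rewrite (_ : (fun h => _) = move) //.
by apply/funext => h; rewrite mulVKf ?gt_eqF.
Qed.

Lemma flow_trans move s t p q r :
  flow X sing move s p q -> flow X sing move t q r -> flow X sing move (s + t) p r.
Proof.
move=> [s0 [g [geo g0 gs]]] [t0 [g' [geo' g0' gt']]]; split; first exact: addr_ge0.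
exists (fun u => if u <= s then g u else g' (u - s)); split; last 2 first.
- by rewrite s0.
- have [|_] := leP (s + t) s; last by rewrite addrAC subrr add0r.
  rewrite gerDl => t0'; have t00 : t = 0 by lra.
  by rewrite t00 addr0 gs -gt' t00 g0'.
move=> u /andP[u0 ut].
have [us|su] := leP u s.
  have [|Xg /near0P[e e0 he]] := geo u; first by rewrite u0.
  split => //; apply/near0P.
  have [uss|uss] := eqVneq u s; last first.
    have lus : u < s by rewrite lt_neqAle uss.
    exists (Num.min e (s - u)); first by rewrite lt_min e0 subr_gt0.
    move=> h; rewrite lt_min => /andP[h1 h2] hh.
    have := ler_norm h => h3; rewrite ifT; last by lra.
    by apply: he => //; lra.
  have [|_ /near0P[e' e0' he']] := geo' 0; first by rewrite lexx.
  exists (Num.min e e'); first by rewrite lt_min e0.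
  move=> h; rewrite lt_min uss => /andP[h1 h2] hh.
  case: leP => hs; first by rewrite -uss he // uss; lra.
  by rewrite gs -g0' -he' //; [congr g'; ring | lra].
have [|Xg /near0P[e e0 he]] := geo' (u - s); first lra.
split => //; apply/near0P; exists (Num.min e (u - s)).
  by rewrite lt_min e0 subr_gt0.
move=> h; rewrite lt_min => /andP[h1 h2] hh.
have : - h <= `|h| by rewrite -normrN ler_norm.
move=> h3; rewrite ifF; last by apply/negbTE; rewrite -ltNge; lra.
by rewrite addrAC he //; lra.
Qed.

End Flow.

Section Surface.
Variables (R : realType) (P : polysquare) (a b : R).

Definition shift_along (t : R) (x : R * R) : R * R := (x.1 + t * a, x.2 + t * b).
Definition fracs (x : R * R) : R * R := (frac x.1, frac x.2).

Definition dirflow2 : R -> point2 R P -> point2 R P -> Prop :=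
  flow (@surface R P) (@singular2 R P) (fun h => translate2 (h * a) (h * b)).

Definition dirflow3 (c : R) : R -> point3 R P -> point3 R P -> Prop :=
  flow (@manifold R P) (@singular3 R P)
    (fun h => translate3 (h * a) (h * b) (h * c)).

Lemma flow_lift c t p q z : 0 <= z < 1 -> dirflow2 t p q ->
  dirflow3 c t (p, z) (q, frac (z + t * c)).
Proof.
move=> hz [t0 [g [geo g0 gt]]]; split => //.
exists (fun s => (g s, frac (z + s * c))); split; last 2 first.
- by rewrite g0 mul0r addr0 frac_id.
- by rewrite gt.
move=> s hs; have [[Xg ng] loc] := geo s hs; split.
  by split => //; split => //=; rewrite frac_ge0 frac_lt1.
move: loc => /near0P[e e0 he]; apply/near0P; exists e => // h h1 h2.
by rewrite /translate3 /= he // frac_fracD mulrDl addrA.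
Qed.

Lemma flow_proj c t p q : dirflow3 c t p q -> dirflow2 t p.1 q.1.
Proof.
move=> [t0 [g [geo g0 gt]]]; split => //.
exists (fun s => (g s).1); split; [|by rewrite g0|by rewrite gt].
move=> s hs; have [[[Xg _] ng] /near0P[e e0 he]] := geo s hs; split => //.
by apply/near0P; exists e => // h h1 h2; rewrite he.
Qed.

(** For [(a, b)] nonzero, the line through [x] in the direction [(a, b)] contains
no lattice point. *)
Definition nonresonant (x : R * R) := forall m n : int,
  b * (x.1 - m%:~R) <> a * (x.2 - n%:~R).

Lemma nonresonant_shift t x : nonresonant x -> nonresonant (shift_along t x).
Proof. by move=> nr m n /= h; apply: (nr m n); nra. Qed.

Lemma nonresonantDz (m n : int) x : nonresonant x ->
  nonresonant (x.1 + m%:~R, x.2 + n%:~R).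
Proof.
move=> nr m' n' /= h; apply: (nr (m' - m) (n' - n)).
by rewrite !rmorphB /= !opprB !addrA ![_ + _%:~R]addrC in h *; rewrite -!addrA in h *.
Qed.

Lemma nonresonant_nonint x : nonresonant x -> frac x.1 = 0 -> frac x.2 = 0 -> False.
Proof.
move=> nr /frac_eq0 h1 /frac_eq0 h2.
by apply: (nr (Num.floor x.1) (Num.floor x.2)); rewrite -h1 -h2 !subrr !mulr0.
Qed.

(** Translations compose as long as no horizontal edge is crossed; crossing
edges of both kinds would require [right P] and [up P] to commute. *)
Lemma translate2Dx a1 b1 a2 b2 (p : point2 R P) :
  Num.floor (p.2.2 + b1) = 0 -> Num.floor (p.2.2 + (b1 + b2)) = 0 ->
  translate2 a2 b2 (translate2 a1 b1 p) = translate2 (a1 + a2) (b1 + b2) p.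
Proof.
move=> h1 h2; rewrite /translate2 /= !frac_fracD !floor_fracD -!addrA h1 h2 subrr /=.
by rewrite crossD [X in cross _ X _]addrC subrK.
Qed.

Lemma translate2Dy a1 b1 a2 b2 (p : point2 R P) :
  Num.floor (p.2.1 + a1) = 0 -> Num.floor (p.2.1 + (a1 + a2)) = 0 ->
  translate2 a2 b2 (translate2 a1 b1 p) = translate2 (a1 + a2) (b1 + b2) p.
Proof.
move=> h1 h2; rewrite /translate2 /= !frac_fracD !floor_fracD -!addrA h1 h2 subrr /=.
by rewrite crossD [X in cross _ X _]addrC subrK.
Qed.

Lemma floor_near0 (x c : R) : 0 < x < 1 ->
  exists2 e, 0 < e & forall h, `|h| < e -> Num.floor (x + h * c) = 0.
Proof.
move=> /andP[x0 x1].
have cp : 0 < `|c| + 1 by rewrite ltr_wpDl.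
exists (Num.min x (1 - x) / (`|c| + 1)).
  by rewrite divr_gt0 // lt_min x0 subr_gt0.
move=> h; rewrite ltr_pdivlMr // lt_min => /andP[h1 h2].
have h3 : `|h * c| <= `|h| * (`|c| + 1) by rewrite normrM ler_wpM2l // lerDl.
have := ler_norm (h * c); have := ler_norm (- (h * c)); rewrite normrN => h4 h5.
by apply: floor_def; rewrite add0r mulr0z mulr1z; apply/andP; split; lra.
Qed.

(** Away from the vertices one of the coordinates is not an integer, and it stays
so for small times; the edges of the corresponding kind are not crossed. *)
Lemma translate2_local (u : R * R) : 0 <= u.1 < 1 -> 0 <= u.2 < 1 ->
  ~ (u.1 = 0 /\ u.2 = 0) ->
  exists2 e, 0 < e & forall (i : square P) h h', `|h| < e -> `|h'| < e ->
    translate2 ((h' - h) * a) ((h' - h) * b) (translate2 (h * a) (h * b) (i, u)) =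
    translate2 (h' * a) (h' * b) (i, u).
Proof.
move=> /andP[x0 x1] /andP[y0 y1] n0.
have [x00|xn0] := eqVneq u.1 0.
  have yp : 0 < u.2 < 1.
    by rewrite y1 andbT lt_neqAle y0 andbT eq_sym; apply/eqP => h; apply: n0.
  have [e e0 he] := floor_near0 b yp; exists e => // i h h' h1 h2.
  rewrite translate2Dx; first by rewrite -!mulrDl [h + _]addrC subrK.
    by rewrite /= he.
  by rewrite -mulrDl [h + _]addrC subrK /= he.
have xp : 0 < u.1 < 1 by rewrite x1 andbT lt_neqAle x0 andbT eq_sym.
have [e e0 he] := floor_near0 a xp; exists e => // i h h' h1 h2.
rewrite translate2Dy; first by rewrite -!mulrDl [h + _]addrC subrK.
  by rewrite /= he.
by rewrite -mulrDl [h + _]addrC subrK /= he.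
Qed.

Lemma fracs_surface i (x : R * R) : @surface R P (i, fracs x).
Proof. by split => /=; rewrite frac_ge0 frac_lt1. Qed.

Lemma translate2_fracs h (i : square P) x : exists j,
  translate2 (h * a) (h * b) (i, fracs x) = (j, fracs (shift_along h x)).
Proof. by rewrite /translate2 /= !frac_fracD; eexists. Qed.

(** Edge crossings permute the squares, so a translation maps the points over
[x] onto those over the translate of [x]. *)
Lemma translate2_fracs_onto h (j : square P) x : exists i,
  translate2 (h * a) (h * b) (i, fracs x) = (j, fracs (shift_along h x)).
Proof.
exists (cross (right P) (- Num.floor (frac x.1 + h * a))
  (cross (up P) (- Num.floor (frac x.2 + h * b)) j)).
by rewrite /translate2 /= !frac_fracD !crossK.
Qed.

Lemma flow_local x : nonresonant x ->
  exists2 e, 0 < e & forall h h' (i : square P), - e < h -> h <= h' -> h' < e ->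
    dirflow2 (h' - h) (translate2 (h * a) (h * b) (i, fracs x))
      (translate2 (h' * a) (h' * b) (i, fracs x)).
Proof.
move=> nr.
have n0 : ~ ((fracs x).1 = 0 /\ (fracs x).2 = 0).
  by move=> [/= h1 h2]; exact: nonresonant_nonint nr h1 h2.
have [|| e e0 he] := translate2_local _ _ n0; rewrite ?frac_ge0 ?frac_lt1 //.
exists e => // h h' i h1 h2 h3; split; first by rewrite subr_ge0.
exists (fun s => translate2 ((h + s) * a) ((h + s) * b) (i, fracs x)); split.
- move=> s hs; split.
    have [j ->] := translate2_fracs (h + s) i x; split; first exact: fracs_surface.
    move=> [/= [s1 s2] _]; have nr' := @nonresonant_shift (h + s) x nr.
    exact: (nonresonant_nonint nr').
  apply/near0P; exists (e - `|h + s|).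
    by rewrite subr_gt0 ltr_norml; apply/andP; split; lra.
  move=> k k1 k2; rewrite -(he i (h + s) (h + (s + k))).
  + by rewrite addrA [h + s + k]addrC addrK.
  + by rewrite ltr_norml; apply/andP; split; lra.
  + by rewrite ltr_norml; apply/andP; split; lra.
- by rewrite addr0.
- by rewrite addrC subrK.
Qed.

(** The second half is the surjectivity of the flow between two fibres of the
covering of the torus; including it spares inverting the flow. *)
Definition fibres_matched (t t' : R) (x : R * R) :=
  (forall i : square P, exists j : square P,
     dirflow2 (t' - t) (i, fracs (shift_along t x)) (j, fracs (shift_along t' x))) /\
  (forall j : square P, exists i : square P,
     dirflow2 (t' - t) (i, fracs (shift_along t x)) (j, fracs (shift_along t' x))).

Lemma shift_alongD s t x : shift_along t (shift_along s x) = shift_along (s + t) x.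
Proof. by rewrite /shift_along /= !mulrDl !addrA. Qed.

(** The geodesics over a line without lattice points never meet a vertex.  They
can be continued by a short time that depends on the point, and continuous
induction reaches all times. *)
Lemma flow_fibres x t : nonresonant x -> 0 <= t -> fibres_matched 0 t x.
Proof.
move=> nr; move: t; apply: (@continuous_induction R (fun t => fibres_matched 0 t x)).
  have [e e0 he] := flow_local nr.
  have F i : dirflow2 (0 - 0) (i, fracs (shift_along 0 x)) (i, fracs (shift_along 0 x)).
    have [j hj] := translate2_fracs_onto 0 i x.
    by have := he 0 0 j; rewrite hj => F; apply: F; rewrite ?oppr_lt0.
  by split=> i; exists i; exact: F.
move=> s s0; have [e e0 he] := flow_local (nonresonant_shift (t := s) nr).
exists e => // t1 t2 t10 h1 h12 h2 [F1 F2].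
have sh u : shift_along (u - s) (shift_along s x) = shift_along u x.
  by rewrite shift_alongD addrC subrK.
have loc i : dirflow2 (t2 - t1)
    (translate2 ((t1 - s) * a) ((t1 - s) * b) (i, fracs (shift_along s x)))
    (translate2 ((t2 - s) * a) ((t2 - s) * b) (i, fracs (shift_along s x))).
  have -> : t2 - t1 = (t2 - s) - (t1 - s) by ring.
  by apply: he; lra.
have E : t2 - 0 = (t1 - 0) + (t2 - t1) by ring.
split=> i; rewrite /dirflow2 E.
  have [j F] := F1 i.
  have [k hk] := translate2_fracs_onto (t1 - s) j (shift_along s x).
  have [l hl] := translate2_fracs (t2 - s) k (shift_along s x).
  exists l; apply: flow_trans F _.
  by have := loc k; rewrite hk hl !sh.
have [k hk] := translate2_fracs_onto (t2 - s) i (shift_along s x).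
have [j hj] := translate2_fracs (t1 - s) k (shift_along s x).
have [l F] := F2 j; exists l; apply: flow_trans F _.
by have := loc k; rewrite hk hj !sh.
Qed.

End Surface.

(** * Resonant lines and preliminaries on real functions *)

Section Aux.
Variable R : realType.
Local Notation lam := (@lebesgue_measure R).
Local Notation T1 := (measurableTypeR R).
Local Notation T2 := (measurableTypeR R * measurableTypeR R)%type.
Local Notation mu2 := (lam \x lam)%E.

Lemma negligible_bigcup_countable d (T : measurableType d)
    (mu : {measure set T -> \bar R}) (K : countType) (F : K -> set T) :
  (forall k, mu.-negligible (F k)) -> mu.-negligible (\bigcup_k F k).
Proof.
move=> F0.
apply: (@negligibleS _ _ _ mu
  (\bigcup_n (if unpickle n is Some k then F k else set0))).
  by move=> x [k _ Fx]; exists (pickle k) => //; rewrite pickleK.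
apply: negligible_bigcup => n; case: unpickle => [k|]; first exact: F0.
exact: negligible_set0.
Qed.

Lemma measurable_frac : measurable_fun setT (@frac R : T1 -> T1).
Proof.
apply: measurable_funB => //.
apply: nondecreasing_measurable => // x y xy.
by rewrite ler_int; exact: le_floor.
Qed.

Lemma measurable_fracs : measurable_fun setT (@fracs R : T2 -> T2).
Proof.
apply: measurable_fun_pair; apply: (measurableT_comp measurable_frac).
  exact: measurable_fst.
exact: measurable_snd.
Qed.

Definition line (a b : R) (k : int * int) : set T2 :=
  [set x | b * (x.1 - k.1%:~R) = a * (x.2 - k.2%:~R)].

Lemma measurable_line a b k : measurable (line a b k).
Proof.
pose f (x : T2) : R := b * (x.1 - k.1%:~R).
pose g (x : T2) : R := a * (x.2 - k.2%:~R).
have mf : measurable_fun setT f.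
  apply: measurable_funM => //; apply: measurable_funB => //; exact: measurable_fst.
have mg : measurable_fun setT g.
  apply: measurable_funM => //; apply: measurable_funB => //; exact: measurable_snd.
rewrite (_ : line a b k = (f \- g) @^-1` [set 0]); last first.
  apply/seteqP; split => x /=; rewrite /line /f /g /=; first by move=> ->; rewrite subrr.
  by move=> /eqP; rewrite subr_eq0 => /eqP.
rewrite -[X in measurable X]setTI.
by apply: (measurable_funB mf mg) => //; exact: measurable_set1.
Qed.

Lemma line0 a b k : a != 0 -> mu2 (line a b k) = 0%E.
Proof.
move=> a0; rewrite /product_measure1 /=; apply: integral0_eq => x _ /=.
rewrite (_ : xsection _ _ = [set (k.2%:~R + b * (x - k.1%:~R) / a)%R]).
  exact: lebesgue_measure_set1.
apply/seteqP; split => y; rewrite /xsection /= inE /line /=.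
  by move=> ->; rewrite mulrAC mulfV // mul1r addrC subrK.
by move=> ->; rewrite addrAC subrr add0r mulrCA mulfV // mulr1.
Qed.

Lemma nonresonantE a b : [set x | nonresonant a b x] = ~` \bigcup_k line a b k.
Proof.
apply/seteqP; split => x /=; first by move=> nr [k _]; apply: nr.
by move=> h m n e; apply: h; exists (m, n).
Qed.

Lemma measurable_nonresonant a b : measurable ([set x | nonresonant a b x] : set T2).
Proof.
rewrite nonresonantE; apply: measurableC; apply: countable_bigcupT_measurable => //.
exact: measurable_line.
Qed.

Lemma resonant0 a b : a != 0 -> mu2.-negligible (~` [set x | nonresonant a b x]).
Proof.
move=> a0; rewrite nonresonantE setCK; apply: negligible_bigcup_countable => k.
by exists (line a b k); split => //; [exact: measurable_line | exact: line0].
Qed.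

Lemma avoid_finite (l : seq R) (u w : R) : u < w ->
  exists r s : rat, [/\ u < ratr r, (ratr r : R) < ratr s, ratr s < w &
    forall x, x \in l -> ~ (ratr r < x < ratr s)].
Proof.
move=> uw; elim: l => [|x l [r [s [h1 h2 h3 h4]]]].
  have [r /itvP hr] := rat_in_itvoo uw.
  have rw : ratr r < w by rewrite hr.
  have [s /itvP hs] := rat_in_itvoo rw.
  by exists r, s; rewrite hr !hs.
case: (pselect (ratr r < x < ratr s)) => [/andP[rx xs]|no].
  have [r' /itvP hr] := rat_in_itvoo xs.
  have xr' : x < ratr r' by rewrite hr.
  exists r', s; split => //; [by rewrite (lt_trans h1) // (lt_trans rx) | by rewrite hr|].
  move=> y; rewrite inE => /orP[/eqP->|yl]; first by rewrite ltNge (ltW xr').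
  move=> /andP[y1 y2]; apply: (h4 _ yl); rewrite y2 andbT.
  by rewrite (lt_trans rx) // (lt_trans xr').
exists r, s; split => // y; rewrite inE => /orP[/eqP-> //|]; exact: h4.
Qed.

Lemma lipschitz_continuous (f : R -> R) :
  (forall x y, `|f x - f y| <= `|x - y|) -> continuous f.
Proof.
move=> lip x; apply/cvgrPdist_lt => e e0; apply/nbhs_ballP; exists e => // y xy.
exact: le_lt_trans (lip x y) xy.
Qed.

End Aux.

(** * Fibres of an invariant subset of the 3-manifold *)

Section Fibres.
Variables (R : realType) (P : polysquare) (a b c : R).
Hypothesis indep : forall p q r : rat,
  ratr p * a + ratr q * b + ratr r * c = 0 -> [/\ p = 0, q = 0 & r = 0].
Variable A : set (point3 R P).
Hypothesis mA : measurable3 A.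
Hypothesis invA : invariant_set (@dirflow3 R P a b c) A.

Local Notation lam := (@lebesgue_measure R).
Local Notation T1 := (measurableTypeR R).
Local Notation T2 := (measurableTypeR R * measurableTypeR R)%type.
Local Notation mu2 := (lam \x lam)%E.

(** Extended periodically from the circle to the line, so that rotations of the
circle become translations. *)
Definition fibre (p : point2 R P) : set T1 := [set y | A (p, frac y)].

Definition fibres_graph (i : square P) : set (T2 * T1) :=
  [set xy | A ((i, fracs xy.1), frac xy.2)].

Lemma measurable_fibres_graph i : measurable (fibres_graph i).
Proof.
pose f (xy : T2 * T1) : T2 * T1 := (fracs xy.1, frac xy.2).
have mf : measurable_fun setT f.
  apply: measurable_fun_pair.
    apply: (measurableT_comp (@measurable_fracs R)); exact: measurable_fst.
  apply: (measurableT_comp (@measurable_frac R)); exact: measurable_snd.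
rewrite -[X in measurable X]setTI.
exact: (mf measurableT _ (mA i)).
Qed.

Lemma measurable_fibre p : measurable (fibre p).
Proof.
case: p => i u.
pose f (y : T1) : T2 * T1 := (u, frac y).
have mf : measurable_fun setT f.
  by apply: measurable_fun_pair => //; exact: measurable_frac.
rewrite -[X in measurable X]setTI.
exact: (mf measurableT _ (mA i)).
Qed.

Lemma fibre_flow t p q : dirflow2 a b t p q ->
  fibre p = (fun y => y + t * c) @^-1` fibre q.
Proof.
move=> F.
have L y : A (p, frac y) <-> A (q, frac (y + t * c)).
  have f01 : 0 <= frac y < 1 by rewrite frac_ge0 frac_lt1.
  by rewrite -frac_fracD; exact: invA (flow_lift c f01 F).
by apply/seteqP; split => y /L.
Qed.

Lemma fibre_period p : fibre p = (fun y => y + 1) @^-1` fibre p.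
Proof. by apply/seteqP; split => y; rewrite /fibre /= -[1]/(1%:~R) fracDz. Qed.

Definition arc (d z : R) (p : point2 R P) : R := window1 (fibre p) d z.

Lemma arc_flow d z t p q : 0 <= d -> dirflow2 a b t p q ->
  arc d (z + t * c) q = arc d z p.
Proof.
by move=> d0 F; rewrite /arc window1_shift -?(fibre_flow F) //; exact: measurable_fibre.
Qed.

Lemma arc_period d z p : 0 <= d -> arc d (z + 1) p = arc d z p.
Proof.
by move=> d0; rewrite /arc window1_shift -?fibre_period //; exact: measurable_fibre.
Qed.

(** For fixed [d], [r] and [s], these are the sections of a subset of the torus of
dimension 3 that is invariant under the linear flow with direction [(a, b, c)]
([attains_flow]). *)
Definition attains (d r s z : R) : set T2 :=
  [set x | nonresonant a b x /\ exists i : square P, r < arc d z (i, fracs x) < s].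

Lemma measurable_arc d z i : 0 <= d ->
  measurable_fun setT ((fun x => arc d z (i, fracs x)) : T2 -> T1).
Proof.
move=> d0.
pose S := fibres_graph i `&` ([set: T2] `*` (`]z, (z + d)%R]%classic : set T1)).
have mS : measurable S.
  apply: measurableI; first exact: measurable_fibres_graph.
  by apply: measurableX => //; exact: measurable_itv.
rewrite (_ : (fun x => _) = fine \o (lam \o xsection S)).
  apply: measurableT_comp => //; exact: measurable_fun_xsection.
apply/funext => x; congr (fine (lam _)); apply/seteqP; split => y.
  by move=> [h1 h2]; rewrite /xsection /= inE.
by rewrite /xsection /= inE => -[h1 [_ h2]].
Qed.

Lemma measurable_attains d r s z : 0 <= d -> measurable (attains d r s z).
Proof.
move=> d0.
rewrite (_ : attains d r s z = [set x | nonresonant a b x] `&`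
  \bigcup_(i : square P) ((fun x => arc d z (i, fracs x)) @^-1` `]r, s[)).
  apply: measurableI; first exact: measurable_nonresonant.
  apply: countable_bigcupT_measurable => // i.
  rewrite -[X in measurable X]setTI.
  by apply: (measurable_arc z i d0) => //; exact: measurable_itv.
apply/seteqP; split => x /= [nr].
  by move=> [i h]; split => //; exists i => //=; rewrite in_itv.
by move=> [i _] /=; rewrite in_itv /= => h; split => //; exists i.
Qed.

Lemma attains_flow d r s z t x : 0 <= d ->
  attains d r s z x <-> attains d r s (z + t * c) (shift_along a b t x).
Proof.
move=> d0.
have H z' t' x' : 0 <= t' ->
    attains d r s z' x' <-> attains d r s (z' + t' * c) (shift_along a b t' x').
  move=> t0; have s0 : shift_along a b 0 x' = x'.
    by rewrite /shift_along !mul0r !addr0; case: x'.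
  split=> -[nr [i hi]].
    split; first exact: nonresonant_shift.
    have [F _] := flow_fibres P nr t0; have [j] := F i.
    by rewrite subr0 s0 => Fj; exists j; rewrite (arc_flow z' d0 Fj).
  have nr' : nonresonant a b x'.
    have := nonresonant_shift (t := - t') nr.
    by rewrite shift_alongD subrr s0.
  split => //; have [_ F] := flow_fibres P nr' t0; have [j] := F i.
  by rewrite subr0 s0 => Fj; exists j; rewrite -(arc_flow z' d0 Fj).
have [t0|t0] := leP 0 t; first exact: H.
have := H (z + t * c) (- t) (shift_along a b t x).
rewrite shift_alongD subrr mulNr addrK oppr_ge0 => /(_ (ltW t0)) ->.
have -> : shift_along a b 0 x = x by rewrite /shift_along !mul0r !addr0; case: x.
by [].
Qed.

Lemma attains_int d r s z (m n : int) x :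
  attains d r s z (shift2 m%:~R n%:~R x) <-> attains d r s z x.
Proof.
have E y k l : fracs (shift2 k%:~R l%:~R y) = fracs y :> R * R.
  by rewrite /fracs /shift2 /= !fracDz.
have H k l y : attains d r s z y -> attains d r s z (shift2 k%:~R l%:~R y).
  move=> [nr [i hi]]; split; first exact: nonresonantDz.
  by exists i; rewrite E.
split; last exact: H.
move/(H (- m) (- n)).
by rewrite /shift2 /= !rmorphN /= !addrK; case: x.
Qed.

Lemma a_neq0 : a != 0.
Proof.
apply/eqP => a0; have [|+ _ _] := indep (p := 1) (q := 0) (r := 0).
  by rewrite a0 !rmorph0 !mul0r mulr0 !addr0.
by move/eqP; rewrite oner_eq0.
Qed.

Lemma c_neq0 : c != 0.
Proof.
apply/eqP => c0; have [|_ _ +] := indep (p := 0) (q := 0) (r := 1).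
  by rewrite c0 !rmorph0 !mul0r mulr0 !addr0.
by move/eqP; rewrite oner_eq0.
Qed.

Lemma attains_period d r s z : 0 <= d -> attains d r s (z + 1) = attains d r s z.
Proof.
move=> d0; apply/seteqP; split => x [nr [i]].
  by rewrite arc_period // => hi; split => //; exists i.
by rewrite -(arc_period z) // => hi; split => //; exists i.
Qed.

Lemma attains_shift d r s z : 0 <= d ->
  attains d r s z = shift2 (- z / c * a) (- z / c * b) @^-1` attains d r s 0.
Proof.
move=> d0; apply/seteqP; split => x /=.
  move/(attains_flow r s z (- z / c) x d0).
  by rewrite divfK ?c_neq0 // subrr.
move=> h; apply/(attains_flow r s z (- z / c) x d0).
by rewrite divfK ?c_neq0 // subrr.
Qed.

(** In time [1 / c] the linear flow returns to the section at height [z], by the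
translation [(a / c, b / c)]. *)
Lemma attains01 d r s z : 0 <= d ->
  mu2 (attains d r s z) = 0%E \/ mu2 (~` attains d r s z) = 0%E.
Proof.
move=> d0; apply: (@zero_one2 _ _ (a / c) (b / c)).
- exact: measurable_attains.
- by move=> p; have := attains_int d r s z 1 0 p; rewrite mulr1z mulr0z.
- by move=> p; have := attains_int d r s z 0 1 p; rewrite mulr1z mulr0z.
- move=> p; rewrite -[X in X _ <-> _](attains_period _ _ _ d0).
  have := attains_flow r s z c^-1 p d0.
  rewrite mulVf ?c_neq0 // /shift_along /shift2 ![c^-1 * _]mulrC => h.
  by split => /h.
move=> p q r' h; have [|h1 h2 h3] := indep (p := q) (q := r') (r := p); last by [].
have -> : ratr q * a + ratr r' * b + ratr p * c =
    (ratr p + ratr q * (a / c) + ratr r' * (b / c)) * c.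
  by field; exact: c_neq0.
by rewrite h mul0r.
Qed.

(** The sections at different heights are translates of each other, so the
alternative does not depend on [z]. *)
Lemma attains_dichotomy d r s : 0 <= d ->
  (forall z, mu2 (attains d r s z) = 0%E) \/ (forall z, mu2 (~` attains d r s z) = 0%E).
Proof.
move=> d0; have m0 := measurable_attains r s 0 d0.
have [h|h] := attains01 r s 0 d0; [left|right] => z; rewrite (attains_shift _ _ _ d0).
  by rewrite leb2_shift.
by rewrite -h -[RHS](@leb2_shift R (- z / c * a) (- z / c * b)) //; exact: measurableC.
Qed.

Definition charged d r s := forall z, mu2 (~` attains d r s z) = 0%E.

(** Rational parameters keep the union of these null sets countable. *)
Definition exceptional (k : (rat * rat) * (rat * rat)) : set T2 :=
  let d := ratr k.1.1 in let z := ratr k.1.2 in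
  let r := ratr k.2.1 in let s := ratr k.2.2 in
  [set x | 0 <= d /\ ~ (attains d r s z x <-> charged d r s)].

Lemma negligible_exceptional k : mu2.-negligible (exceptional k).
Proof.
case: k => [[d' z'] [r' s']]; rewrite /exceptional /=.
set d := ratr d'; set z := ratr z'; set r := ratr r'; set s := ratr s'.
case: (pselect (0 <= d)) => [d0|nd]; last first.
  exists set0; split => //; by move=> x [].
have mE := measurable_attains r s z d0.
case: (pselect (charged d r s)) => [ch|nch].
  exists (~` attains d r s z); split; [exact: measurableC | exact: ch |].
  by move=> x /= [_ h] at_x; apply: h.
have [h|//] := attains_dichotomy r s d0.
exists (attains d r s z); split; [exact: mE | exact: h |].
by move=> x /= [_ h']; apply: contrapT => nat_x; apply: h'.
Qed.

Definition regular : set T2 :=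
  [set x | nonresonant a b x] `&` ~` \bigcup_k exceptional k.

Lemma negligible_irregular : mu2.-negligible (~` regular).
Proof.
rewrite /regular setCI setCK; apply: negligibleU.
  exact: resonant0 a_neq0.
by apply: negligible_bigcup_countable => k; exact: negligible_exceptional.
Qed.

Lemma arc_continuous d p : 0 <= d -> continuous (fun z => arc d z p).
Proof.
move=> d0; apply: lipschitz_continuous => x y.
by apply: window1_lip => //; exact: measurable_fibre.
Qed.

(** If the values at two arguments differed, a rational interval []r, s[] between
them would avoid the finitely many values over [x] at height 0, so that over a
regular [x] no value at a rational height would lie in it.  But by the
intermediate value theorem some value does, and by continuity one at a rational
height. *)
Lemma regular_arc_le (d : rat) x i z1 z2 : 0 <= (ratr d : R) -> regular x ->
  arc (ratr d) z1 (i, fracs x) <= arc (ratr d) z2 (i, fracs x).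
Proof.
move=> d0 [nr gx]; rewrite leNgt; apply/negP => lt21.
have gxE z r s : attains (ratr d) (ratr r) (ratr s) (ratr z) x <->
    charged (ratr d) (ratr r) (ratr s).
  by apply: contrapT => h; apply: gx; exists ((d, z), (r, s)).
have [r [s [h1 h2 h3 h4]]] :=
  avoid_finite [seq arc (ratr d) 0 (j, fracs x) | j <- enum (square P)] lt21.
have nat0 : ~ attains (ratr d) (ratr r) (ratr s) (ratr 0) x.
  move=> [_ [j]]; rewrite rmorph0; apply: h4; apply: map_f; exact: mem_enum.
have nch : ~ charged (ratr d) (ratr r) (ratr s) by move/gxE.
pose f z := arc (ratr d) z (i, fracs x).
have cf : continuous f by exact: arc_continuous.
pose v : R := (ratr r + ratr s) / 2.
have [w fw] : exists w, f w = v.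
  have v1 : f z2 < v by rewrite (lt_trans h1) // /v; lra.
  have v2 : v < f z1 by apply: lt_trans h3; rewrite /v; lra.
  have [z12|z21] := leP z1 z2.
    have [||w _ fw] := @IVT R f z1 z2 v z12; [exact: continuous_subspaceT| |by exists w].
    by rewrite ge_min le_max (ltW v1) (ltW v2) orbT.
  have [||w _ fw] := @IVT R f z2 z1 v (ltW z21); [exact: continuous_subspaceT| |by exists w].
  by rewrite ge_min le_max (ltW v1) (ltW v2) orbT.
pose e : R := (ratr s - ratr r) / 2.
have e0 : 0 < e by rewrite /e; lra.
have lt_w : w < w + e by rewrite ltrDl.
have [z /itvP hz] := rat_in_itvoo lt_w.
have fz : `|f (ratr z) - v| < e.
  rewrite -fw; apply: (@le_lt_trans _ _ `|ratr z - w|).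
    by apply: window1_lip => //; exact: measurable_fibre.
  have z1' : w < ratr z by rewrite hz.
  have z2' : ratr z < w + e by rewrite hz.
  by rewrite gtr0_norm; lra.
apply: nch; apply/(gxE z); split => //; exists i.
move: fz; rewrite ltr_norml /v /e /f => /andP[? ?]; apply/andP; split; lra.
Qed.

(** Windows of rational length suffice, by continuity in the length. *)
Lemma regular_fibre x i : regular x ->
  lam (fibre (i, fracs x)) = 0%E \/ lam (~` fibre (i, fracs x)) = 0%E.
Proof.
move=> gx; have mF := measurable_fibre (i, fracs x).
apply: zero_one1 => //.
have W d z1 z2 : 0 < d -> arc d z1 (i, fracs x) <= arc d z2 (i, fracs x).
  move=> d0; apply/ler_addgt0Pr => e e0.
  have e20 : 0 < e / 2 by rewrite divr_gt0.
  have ltd : d < d + e / 2 by rewrite ltrDl.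
  have [q /itvP hq] := rat_in_itvoo ltd.
  have q1 : d < ratr q by rewrite hq.
  have q2 : ratr q < d + e / 2 by rewrite hq.
  have q0 : 0 <= (ratr q : R) by rewrite ltW // (lt_trans d0).
  have := regular_arc_le i z1 z2 q0 gx.
  have := window1_lip_length z1 mF (ltW d0) q0.
  have := window1_lip_length z2 mF (ltW d0) q0.
  have -> : `|d - ratr q| = ratr q - d by rewrite distrC gtr0_norm ?subr_gt0.
  rewrite -!/(arc _ _ _) !ler_norml => /andP[? ?] /andP[? ?] ?; lra.
by move=> d z1 z2 d0; apply/eqP; rewrite eq_le; apply/andP; split; exact: W.
Qed.

End Fibres.

(** * Transfer of ergodicity between the surface and the 3-manifold *)

Section Volume.
Variables (R : realType) (P : polysquare).
Local Notation lam := (@lebesgue_measure R).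
Local Notation T1 := (measurableTypeR R).
Local Notation T2 := (measurableTypeR R * measurableTypeR R)%type.
Local Notation mu2 := (lam \x lam)%E.
Local Notation mu3 := (mu2 \x lam)%E.

Definition unit_itv : set T1 := `[0, 1[%classic.
Definition unit_square : set T2 := unit_itv `*` unit_itv.

Lemma measurable_unit_itv : measurable unit_itv.
Proof. exact: measurable_itv. Qed.

Lemma measurable_unit_square : measurable unit_square.
Proof. by apply: measurableX; exact: measurable_unit_itv. Qed.

Lemma lam_unit_itv : lam unit_itv = 1%E.
Proof. by rewrite /unit_itv lebesgue_measure_itv /= lte_fin ltr01 -EFinB subr0. Qed.

Lemma slice2_surface i : slice2 (@surface R P) i = unit_square.
Proof. by apply/seteqP; split => x; rewrite /slice2 /unit_square /unit_itv /= !in_itv. Qed.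

Lemma slice3_manifold i : slice3 (@manifold R P) i = unit_square `*` unit_itv.
Proof.
by apply/seteqP; split => x; rewrite /slice3 /unit_square /unit_itv /manifold /= !in_itv.
Qed.

Lemma area0P (B : set (point2 R P)) : area B = 0%E <-> forall i, mu2 (slice2 B i) = 0%E.
Proof.
split; last by move=> h; rewrite /area big1 // => i _; exact: h.
move=> B0 i.
have : (area B = leb2 (slice2 B i) + \sum_(j | j != i) leb2 (slice2 B j))%E.
  by rewrite /area (bigD1 i).
have ge0 j : (0 <= leb2 (slice2 B j))%E by exact: (measure_ge0 mu2).
rewrite B0 => /esym/eqP; rewrite padde_eq0 ?sume_ge0 //.
by move=> /andP[/eqP].
Qed.

Lemma volume_eq0 (C : set (point3 R P)) : measurable3 C ->
  (forall i, mu2.-negligible [set u | lam [set z | C ((i, u), z)] <> 0%E]) ->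
  volume C = 0%E.
Proof.
move=> mC C0; rewrite /volume big1 // => i _; rewrite /leb3 {1}/product_measure1.
have E u : xsection (slice3 C i) u = [set z | C ((i, u), z)].
  by apply/seteqP; split => z; rewrite /xsection /= inE.
rewrite (@ae_eq_integral _ _ _ mu2 setT (fun=> 0%E)) ?integral0 //.
  exact: measurable_fun_xsection.
apply: negligibleS (C0 i) => u /= nh; rewrite -E => h; apply: nh => _; exact: h.
Qed.

Lemma flow_surface a b t p q : @dirflow2 R P a b t p q -> surface p /\ surface q.
Proof.
move=> [t0 [g [geo g0 gt]]].
have [|[s0 _] _] := geo 0; first by rewrite lexx.
have [|[s1 _] _] := geo t; first by rewrite lexx andbT.
by rewrite -g0 -gt.
Qed.

Lemma flow_manifold a b c t p q : @dirflow3 R P a b c t p q -> manifold p /\ manifold q.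
Proof.
move=> [t0 [g [geo g0 gt]]].
have [|[s0 _] _] := geo 0; first by rewrite lexx.
have [|[s1 _] _] := geo t; first by rewrite lexx andbT.
by rewrite -g0 -gt.
Qed.

(** [B] is the set of the points with conull fibre.  It is invariant because
following the flow translates the fibres. *)
Theorem ergodic_lift a b c :
  (forall p q r : rat, ratr p * a + ratr q * b + ratr r * c = 0 ->
     [/\ p = 0, q = 0 & r = 0]) ->
  ergodic (@surface R P) (@measurable2 R P) (@area R P) (@dirflow2 R P a b) ->
  ergodic (@manifold R P) (@measurable3 R P) (@volume R P) (@dirflow3 R P a b c).
Proof.
move=> indep erg A AM mA invA.
pose B : set (point2 R P) := [set p | surface p /\ lam (~` fibre A p) = 0%E].
have mB : measurable2 B.
  move=> i.
  have mG := measurable_fibres_graph mA i.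
  rewrite (_ : slice2 B i = unit_square `&`
      (lam \o xsection (~` fibres_graph A i)) @^-1` [set 0%E]).
    apply: measurableI; first exact: measurable_unit_square.
    rewrite -[X in measurable X]setTI.
    by apply: measurable_fun_xsection => //; exact: measurableC.
  have E u : unit_square u -> xsection (~` fibres_graph A i) u = ~` fibre A (i, u).
    rewrite /unit_square /unit_itv /= !in_itv => -[h1 h2].
    have uu : fracs u = u by rewrite /fracs !frac_id //; case: u {h1 h2}.
    by apply/seteqP; split => z; rewrite /xsection /= inE /fibres_graph /fibre /= uu.
  apply/seteqP; split => u.
    move=> [su l0]; have us : unit_square u by rewrite -(slice2_surface i).
    by split => //=; rewrite E.
  move=> [us l0]; split; first by move: us; rewrite -(slice2_surface i).
  by rewrite -E.
have invB : invariant_set (@dirflow2 R P a b) B.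
  move=> t p q F; have [sp sq] := flow_surface F.
  have : lam (~` fibre A p) = lam (~` fibre A q).
    rewrite (fibre_flow invA F) -(@lebesgue_shift R (t * c) (~` fibre A q)) //.
    by apply: measurableC; exact: measurable_fibre.
  by rewrite /B /= => ->; split => -[].
have fibreE C i u z : C `<=` @manifold R P -> C ((i, u), z) ->
    fracs u = u /\ frac z = z.
  move=> CM /CM [[/= h1 h2] h3]; rewrite /fracs !frac_id //; by case: u {h1 h2}.
have nullS (S F : set T1) : measurable S -> measurable F -> S `<=` F ->
    lam F = 0%E -> lam S = 0%E.
  move=> mS mF SF F0; apply/eqP; rewrite eq_le measure_ge0 andbT -F0.
  by apply: le_measure; rewrite ?inE.
have msec C i u : measurable3 C ->
    measurable ([set z | C ((i : square P, u), z)] : set T1).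
  move=> mC; have := @measurable_xsection _ _ _ _ (slice3 C i) u (mC i).
  rewrite (_ : xsection _ _ = [set z | C ((i, u), z)]) //.
  by apply/seteqP; split => z; rewrite /xsection /= inE.
have [B0|B0] := erg B (fun p h => h.1) mB invB; [left|right].
  apply: volume_eq0 => // i.
  have /area0P/(_ i) Bi := B0.
  have N : mu2.-negligible (slice2 B i `|` ~` regular a b A).
    apply: negligibleU; last exact: (negligible_irregular indep mA invA).
    by exists (slice2 B i); split => //; exact: mB.
  apply: (negligibleS _ N).
    move=> u /= nz; apply: contrapT => /not_orP[nB /contrapT ru].
    apply: nz.
    case: (pselect (surface ((i, u) : point2 R P))) => [su|nsu]; last first.
      rewrite (_ : [set z | _] = set0) ?measure0 //.
      by apply/seteqP; split => z //= /AM[/=].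
    have uu : fracs u = u.
      case: su => /= h1 h2; rewrite /fracs !frac_id //; by case: (u).
    have [] := regular_fibre mA i ru; rewrite uu => l0.
      apply: nullS l0; [exact: msec | exact: measurable_fibre |].
      by move=> z /= h; have [_ zz] := fibreE _ _ _ _ AM h; rewrite /fibre /= zz.
    by case: nB.
have /area0P B0i := B0.
have mC : measurable3 (@manifold R P `\` A).
  move=> i; rewrite (_ : slice3 _ _ = slice3 (@manifold R P) i `\` slice3 A i) //.
  apply: measurableD; last exact: mA.
  rewrite slice3_manifold; apply: measurableX; first exact: measurable_unit_square.
  exact: measurable_unit_itv.
apply: volume_eq0 => // i.
have N : mu2.-negligible (slice2 (@surface R P `\` B) i).
  exists (slice2 (@surface R P `\` B) i); split => //.
  rewrite (_ : slice2 _ _ = slice2 (@surface R P) i `\` slice2 B i) //.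
  apply: measurableD; last exact: mB.
  by rewrite slice2_surface; exact: measurable_unit_square.
apply: (negligibleS _ N) => u /= nz; apply: contrapT => h; apply: nz.
case: (pselect (surface ((i, u) : point2 R P))) => [su|nsu]; last first.
  rewrite (_ : [set z | _] = set0) ?measure0 //.
  by apply/seteqP; split => z //= -[[/=]].
have [_ l0] : B (i, u) by apply: contrapT => nB; apply: h; split.
apply: nullS l0; first exact: (msec _ i u mC).
  by apply: measurableC; exact: measurable_fibre.
move=> z /= [hM hA]; have [_ zz] := fibreE _ _ _ _ (@subset_refl _ _) hM.
by rewrite /fibre /= zz.
Qed.

Theorem ergodic_proj a b c :
  ergodic (@manifold R P) (@measurable3 R P) (@volume R P) (@dirflow3 R P a b c) ->
  ergodic (@surface R P) (@measurable2 R P) (@area R P) (@dirflow2 R P a b).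
Proof.
move=> erg B BS mB invB.
pose cyl (C : set (point2 R P)) : set (point3 R P) := C `*` [set z | 0 <= z < 1].
have sl C i : slice3 (cyl C) i = slice2 C i `*` unit_itv.
  by apply/seteqP; split => x; rewrite /slice3 /cyl /unit_itv /= in_itv.
have vol C : measurable2 C -> volume (cyl C) = area C.
  move=> mC; apply: eq_bigr => i _; rewrite sl /leb3 product_measure1E //.
  - transitivity (mu2 (slice2 C i) * lam unit_itv)%E => //.
    by rewrite lam_unit_itv mule1.
  - exact: measurable_unit_itv.
have mS : measurable2 (@surface R P `\` B).
  move=> i; rewrite (_ : slice2 _ _ = slice2 (@surface R P) i `\` slice2 B i) //.
  apply: measurableD; last exact: mB.
  by rewrite slice2_surface; exact: measurable_unit_square.
have [|||h|h] := erg (cyl B).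
- by move=> q [/= /BS].
- by move=> i; rewrite sl; apply: measurableX; [exact: mB | exact: measurable_unit_itv].
- move=> t p q F; have [[_ p2] [_ q2]] := flow_manifold F.
  have := invB _ _ _ (flow_proj F); rewrite /cyl /= => E.
  by split => -[/E].
- by left; rewrite -vol.
right; rewrite -vol // -h; congr volume; apply/seteqP; split => q.
  by move=> [[/= h1 h2] h3]; split => // -[].
by move=> [[h1 h3] h2]; split => //; split => // h4; apply: h2.
Qed.

End Volume.

(** * Kronecker directions *)

Section Directions.
Variable R : realType.

Lemma kronecker2P (v : 'rV[R]_2) : kronecker v ->
  forall p q : rat, ratr p * v 0 0 + ratr q * v 0 1 = 0 -> p = 0 /\ q = 0.
Proof.
move=> kv p q h; pose f (i : 'I_2) : rat := [:: p; q]`_i.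
have : \sum_(i < 2) ratr (f i) * v 0 i = 0.
  rewrite big_ord_recl big_ord1 /f /= -[RHS]h; congr (_ + _ * v _ _); exact: val_inj.
by move=> /kv f0; split; [have := f0 0 | have := f0 1].
Qed.

Lemma row_mx0 (v : 'rV[R]_2) (w : R) : row_mx v (w%:M : 'rV[R]_1) 0 0 = v 0 0.
Proof.
rewrite -(row_mxEl v (w%:M : 'rV[R]_1)).
by congr (row_mx _ _ _ _); exact: val_inj.
Qed.

Lemma row_mx1 (v : 'rV[R]_2) (w : R) : row_mx v (w%:M : 'rV[R]_1) 0 1 = v 0 1.
Proof.
rewrite -(row_mxEl v (w%:M : 'rV[R]_1)).
by congr (row_mx _ _ _ _); exact: val_inj.
Qed.

Lemma row_mx2 (v : 'rV[R]_2) (w : R) : row_mx v (w%:M : 'rV[R]_1) 0 2 = w.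
Proof.
have -> : (2 : 'I_(2 + 1)) = rshift 2 (0 : 'I_1) by exact: val_inj.
by rewrite row_mxEr mxE eqxx mulr1n.
Qed.

Lemma kronecker3P (v : 'rV[R]_2) (w : R) :
  kronecker (row_mx v (w%:M : 'rV[R]_1)) <->
  forall p q r : rat, ratr p * v 0 0 + ratr q * v 0 1 + ratr r * w = 0 ->
    [/\ p = 0, q = 0 & r = 0].
Proof.
have E (f : 'I_(2 + 1) -> rat) :
    \sum_(i < 2 + 1) ratr (f i) * row_mx v (w%:M : 'rV[R]_1) 0 i =
    ratr (f 0) * v 0 0 + ratr (f 1) * v 0 1 + ratr (f 2) * w.
  set u := row_mx v _.
  transitivity (ratr (f 0) * u 0 0 + ratr (f 1) * u 0 1 + ratr (f 2) * u 0 2).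
    rewrite big_ord_recl big_ord_recl big_ord1 addrA.
    by congr (_ + ratr (f _) * u _ _ + ratr (f _) * u _ _); exact: val_inj.
  by rewrite row_mx0 row_mx1 row_mx2.
split=> kv.
  move=> p q r h; pose f (i : 'I_(2 + 1)) : rat := [:: p; q; r]`_i.
  by have f0 := kv f (etrans (E f) h); split; [have := f0 0 | have := f0 1 | have := f0 2].
move=> f; rewrite E => /kv[f0 f1 f2] i.
by case: i => -[|[|[|//]]] hi; [rewrite -[RHS]f0|rewrite -[RHS]f1|rewrite -[RHS]f2];
  congr f; exact: val_inj.
Qed.

(** The rational span of the coordinates of [v] is countable, hence a null set. *)
Lemma kronecker_extension (v : 'rV[R]_2) : kronecker v ->
  exists w : R, kronecker (row_mx v (w%:M : 'rV[R]_1)).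
Proof.
move=> /kronecker2P kv.
pose S : set R := range (fun k : rat * rat => ratr k.1 * v 0 0 + ratr k.2 * v 0 1).
have cS : countable S by apply: (card_le_trans (card_image_le _ _)); exact: countableP.
have [w nw] : exists w, ~ S w.
  apply: contrapT => /forallNP h.
  have : @lebesgue_measure R setT = 0%E.
    rewrite (_ : setT = S); first exact: countable_lebesgue_measure0.
    by apply/seteqP; split => x // _; exact: contrapT (h x).
  by rewrite -set_itvE lebesgue_measure_itv.
exists w; apply/kronecker3P => p q r h.
have [r0|r0] := eqVneq r 0.
  by move: h; rewrite r0 rmorph0 mul0r addr0 => /kv[-> ->].
have r0' : (ratr r : R) != 0 by rewrite fmorph_eq0.
case: nw; exists (- (p / r), - (q / r)) => //=.
have -> : w = - (ratr p * v 0 0 + ratr q * v 0 1) / ratr r.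
  apply: (mulIf r0'); rewrite divfK //; apply/eqP.
  by rewrite -addr_eq0 addrC [w * _]mulrC h.
by rewrite !rmorphN !rmorphM !fmorphV /=; field.
Qed.

Lemma euclid_norm_gt0 d (v : 'rV[R]_d) i : v 0 i != 0 -> 0 < euclid_norm v.
Proof.
move=> vi; rewrite /euclid_norm sqrtr_gt0 (bigD1 i) //=.
apply: ltr_wpDr; first by apply: sumr_ge0 => j _; exact: sqr_ge0.
by rewrite lt_neqAle eq_sym sqrf_eq0 vi sqr_ge0.
Qed.

End Directions.

Lemma ergodic_ext (R : realType) (T : Type) (X : set T) (meas : set (set T))
    (mu : set T -> \bar R) (F F' : R -> T -> T -> Prop) :
  (forall A, invariant_set F A <-> invariant_set F' A) ->
  ergodic X meas mu F <-> ergodic X meas mu F'.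
Proof. by move=> h; split => erg A AX mA /h iA; exact: erg. Qed.

Lemma ergodic2E (R : realType) (P : polysquare) (v : 'rV[R]_2) : v 0 0 != 0 ->
  ergodic2 P v <-> ergodic (@surface R P) (@measurable2 R P) (@area R P)
    (@dirflow2 R P (v 0 0) (v 0 1)).
Proof.
move=> /euclid_norm_gt0 n0; apply: ergodic_ext => A.
have c0 : 0 < (euclid_norm v)^-1 by rewrite invr_gt0.
apply: iff_trans (invariant_rescale (surface (P := P)) (singular2 (P := P))
  (fun h => translate2 (h * v 0 0) (h * v 0 1)) A c0).
rewrite (_ : geodesic_flow2 v = flow (@surface R P) (@singular2 R P)
  (fun h => let h' := (euclid_norm v)^-1 * h in
            translate2 (h' * v 0 0) (h' * v 0 1))) //.
congr (flow _ _); apply/funext => h.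
by rewrite /unit_vector !mxE !mulrA ![_ * h]mulrC.
Qed.

Lemma ergodic3E (R : realType) (P : polysquare) (v : 'rV[R]_2) (w : R) : v 0 0 != 0 ->
  ergodic3 P (row_mx v (w%:M : 'rV[R]_1)) <->
  ergodic (@manifold R P) (@measurable3 R P) (@volume R P)
    (@dirflow3 R P (v 0 0) (v 0 1) w).
Proof.
set u := row_mx v _ => v0.
have c0 : 0 < (euclid_norm u)^-1.
  by rewrite invr_gt0 (@euclid_norm_gt0 _ _ _ 0) // /u row_mx0.
apply: ergodic_ext => A.
apply: iff_trans (invariant_rescale (manifold (P := P)) (singular3 (P := P))
  (fun h => translate3 (h * v 0 0) (h * v 0 1) (h * w)) A c0).
rewrite (_ : geodesic_flow3 u = flow (@manifold R P) (@singular3 R P)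
  (fun h => let h' := (euclid_norm u)^-1 * h in
            translate3 (h' * v 0 0) (h' * v 0 1) (h' * w))) //.
congr (flow _ _); apply/funext => h.
rewrite /unit_vector ![(_ *: u) 0 _]mxE {2 4 6}/u row_mx0 row_mx1 row_mx2.
by rewrite !mulrA ![_ * h]mulrC.
Qed.

Theorem theorem7 (R : realType) (P : polysquare) (v : 'rV[R]_2) :
  kronecker v ->
  (ergodic2 P v <->
   forall w : R, kronecker (row_mx v (w%:M : 'rV[R]_1)) ->
     ergodic3 P (row_mx v (w%:M : 'rV[R]_1))).
Proof.
move=> kv.
have v00 : v 0 0 != 0.
  apply/eqP => v0; have [|+ _] := kronecker2P kv (p := 1) (q := 0).
    by rewrite v0 rmorph0 mulr0 mul0r addr0.
  by move/eqP; rewrite oner_eq0.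
split.
  move=> /(ergodic2E P v00) erg w /kronecker3P indep.
  by apply/(ergodic3E P w v00); exact: ergodic_lift indep erg.
move=> erg; have [w kw] := kronecker_extension kv.
by apply/(ergodic2E P v00); exact: ergodic_proj ((ergodic3E P w v00).1 (erg w kw)).
Qed.
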